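(* Let $K$ be a number field of degree $d$ with signature $(r_1,r_2)$ and absolute discriminant $\Delta$. Let $c(K)=\max\left(|\Delta|\left(\frac{8}{\pi^2}\right)^{r_2}\frac{d!}{d^d},1\right)$, let $M>c(K)$ be a rational integer, and let $\epsilon\in(0,1)$ be a real number such that every ideal class of $\mathrm{Cl}(K)$ contains an integral ideal $\mathfrak{A}$ with the property: for each $\xi\in K$ there exist $\tau\in\mathfrak{A}$ and a rational integer $0<j<M$ with $|\sigma(j\xi-\tau)|<\epsilon$ for every embedding $\sigma:K\to\mathbb{C}$. Let $T_0=e^{\rho_\infty(K)}$ and \[ c(M,K)=\left(\frac{M}{\epsilon T_0\left(\sqrt[d]{\frac{1-\epsilon^d}{\epsilon^d T_0^d}+1}-1\right)}\right)^{d}. \] Then, setting $\mathcal{T}=\{1,\ldots,M\}$, the field $K$ satisfies the $(\mathfrak{P},\mathcal{T})$-adic CFF property for every prime ideal $\mathfrak{P}$ of $\mathcal{O}_K$ with $\mathcal{N}(\mathfrak{P})>c(M,K)$.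
   Context: Logarithmic embedding: with real embeddings $\sigma_1,\ldots,\sigma_{r_1}$ and representatives $\tau_1,\ldots,\tau_{r_2}$ of pairs of complex conjugate embeddings, $\ell(x)=(\log|\sigma_i(x)|)_{i\le r_1}\times(2\log|\tau_j(x)|)_{j\le r_2}\in\mathbb{R}^{r_1+r_2}$ for $x\in K^\times$. $\rho_\infty(K)=\sup_{\mathbf{v}\in\mathrm{Span}(\Lambda_K)}\min_{\mathbf{w}\in\Lambda_K}\|\mathbf{v}-\mathbf{w}\|_\infty$ is the sup-norm covering radius of the lattice $\Lambda_K=\ell(\mathcal{O}_K^\times)$. $\mathcal{N}(\mathfrak{P})=|\mathcal{O}_K/\mathfrak{P}|$. Absolute values: for a place $w$ over $v\in\mathcal{M}_\mathbb{Q}$, $|x|_w=|N_{K_w/\mathbb{Q}_v}(x)|_v^{1/[K_w:\mathbb{Q}_v]}$ with standard normalizations. $\mathcal{O}_{\{\mathfrak{P}\}}=\{\alpha\in K: v_\mathfrak{Q}(\alpha)\ge0\ \forall\text{ primes }\mathfrak{Q}\ne\mathfrak{P}\}$. For a finite $\mathcal{T}\subset\mathcal{O}_K\setminus\{0\}$, a $\mathfrak{P}$-adic $\mathcal{T}$-floor function for $K$ is $s:K_\mathfrak{P}\to K$ with (i) $\alpha-s(\alpha)\in\mathfrak{P}\mathcal{O}_\mathfrak{P}$ for all $\alpha$; (ii) for every $\alpha$ there is $t\in\mathcal{T}$ with $t\,s(\alpha)\in\mathcal{O}_{\{\mathfrak{P}\}}$; (iii) $s(0)=0$; (iv) $\alpha-\beta\in\mathfrak{P}\mathcal{O}_\mathfrak{P}\Rightarrow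 s(\alpha)=s(\beta)$. The expansion of $\alpha$ of type $(K,\mathfrak{P},\mathcal{T},s)$ is $[a_0,a_1,\ldots]$ with $\alpha_0=\alpha$, $a_n=s(\alpha_n)$, $\alpha_{n+1}=1/(\alpha_n-a_n)$ if $\alpha_n\ne a_n$, stopping when $\alpha_n=a_n$. $K$ satisfies the $(\mathfrak{P},\mathcal{T})$-adic CFF property if some such $s$ makes every $\alpha\in K$ have a finite expansion. *)

(* Defs.v *)
From HB Require Import structures.
From mathcomp Require Import all_boot all_order all_algebra all_field.
From mathcomp Require Import all_classical all_reals all_analysis.
From mathcomp Require Import finmap complex.
Set Implicit Arguments.
Unset Strict Implicit.
Unset Printing Implicit Defensive.
Import Order.TTheory GRing.Theory Num.Theory.
Import numFieldNormedType.Exports.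
Local Open Scope classical_set_scope.
Local Open Scope ring_scope.
Local Open Scope complex_scope.

(* Number fields are finite extensions [K : fieldExtType rat]; the degree is
   [\dim {:K}].  Ideals, fractional ideals and the ring of integers are subsets
   of [K]: the ideals of [ring_quotient] are proper by definition, which would
   exclude the unit ideal. *)

Definition ring_of_integers (K : fieldExtType rat) : set K :=
  [set x | integralOver (intr : int -> K) x].

Definition unit_group (K : fieldExtType rat) : set K :=
  [set x | [/\ x != 0, ring_of_integers x & ring_of_integers x^-1]].

Definition field_trace (K : fieldExtType rat) (x : K) : rat :=
  \sum_(i < \dim {:K}) coord (vbasis {:K}) i (x * (vbasis {:K})`_i).

Definition integral_basis (K : fieldExtType rat) (b : (\dim {:K}).-tuple K) :=
  basis_of {:K} b /\
  forall x : K, ring_of_integers x <->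
    exists c : 'I_(\dim {:K}) -> int, x = \sum_i (c i)%:~R * b`_i.

Definition is_discriminant (K : fieldExtType rat) (D : int) :=
  exists2 b : (\dim {:K}).-tuple K, integral_basis b &
    D%:~R = \det (\matrix_(i < \dim {:K}, j < \dim {:K})
                     field_trace (b`_i * b`_j)).

Definition integral_ideal (K : fieldExtType rat) (I : set K) :=
  [/\ I `<=` @ring_of_integers K, I 0,
      (forall x y, I x -> I y -> I (x + y)) &
      (forall a x, ring_of_integers a -> I x -> I (a * x))].

Definition fractional_ideal (K : fieldExtType rat) (I : set K) :=
  [/\ I 0 /\ (exists2 x, I x & x != 0),
      (forall x y, I x -> I y -> I (x + y)),
      (forall a x, ring_of_integers a -> I x -> I (a * x)) &
      (exists c, [/\ ring_of_integers c, c != 0 &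
                     forall x, I x -> ring_of_integers (c * x)])].

(* Ideal classes, i.e. elements of the class group: orbits of the fractional
   ideals under multiplication by principal fractional ideals. *)
Definition ideal_class (K : fieldExtType rat) (C : set (set K)) :=
  exists2 I : set K, fractional_ideal I &
    C = [set J | fractional_ideal J /\
                 exists2 x : K, x != 0 & J = [set x * y | y in I]].

(* The zero ideal is excluded. *)
Definition prime_ideal (K : fieldExtType rat) (P : set K) :=
  [/\ integral_ideal P, (exists2 x, P x & x != 0), ~ P 1 &
      forall x y, ring_of_integers x -> ring_of_integers y ->
        P (x * y) -> P x \/ P y].

(* |O_K / I|; it is 0 when the quotient is infinite. *)
Definition ideal_norm (K : fieldExtType rat) (I : set K) : nat :=
  #|` fset_set [set [set y | ring_of_integers y /\ I (y - x)]
               | x in @ring_of_integers K] |%fset.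

(* Additive group generated by the products x * y with x in I and y in J. *)
Definition idealM (F : fieldType) (I J : set F) : set F :=
  [set z | exists n (x y : 'I_n -> F),
     [/\ forall i, I (x i), forall i, J (y i) & z = \sum_i x i * y i]].

Fixpoint idealX (K : fieldExtType rat) (I : set K) (n : nat) : set K :=
  if n is m.+1 then idealM I (idealX I m) else @ring_of_integers K.

(* The valuation attached to a prime Q: an integer x has valuation n when x is
   in Q^n but not in Q^(n+1), extended to K^* by quotients, and +oo at 0. *)
Definition has_order (K : fieldExtType rat) (Q : set K) (x : K) (n : nat) :=
  idealX Q n x /\ ~ idealX Q n.+1 x.

Definition ideal_val (K : fieldExtType rat) (Q : set K) (x : K) : \bar int :=
  if x == 0 then +oo%E else
  (xget 0 [set n : int | exists a b k l,
     [/\ ring_of_integers a /\ ring_of_integers b, x = a / b,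
         has_order Q a k, has_order Q b l & n = k%:Z - l%:Z]])%:E.

(* O_{P}: elements integral at all primes other than P. *)
Definition integers_outside (K : fieldExtType rat) (P : set K) : set K :=
  [set x | forall Q : set K, prime_ideal Q -> Q <> P ->
             (0 <= ideal_val Q x)%E].

(* K_P is determined up to unique isomorphism as a complete valued field
   containing K densely, with a valuation extending that of P. *)
Record completion (K : fieldExtType rat) (P : set K) := Completion {
  completion_field :> fieldType;
  completion_emb : {rmorphism K -> completion_field};
  completion_val : completion_field -> \bar int;
  completion_val_pinfty : forall x, completion_val x = +oo%E <-> x = 0;
  completion_val_ninfty : forall x, completion_val x <> -oo%E;
  completion_valM : forall x y,
    completion_val (x * y) = (completion_val x + completion_val y)%E;
  completion_valD : forall x y,
    (Order.min (completion_val x) (completion_val y)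
       <= completion_val (x + y))%E;
  completion_val_emb : forall x : K,
    completion_val (completion_emb x) = ideal_val P x;
  completion_dense : forall (x : completion_field) (N : int),
    exists y : K, (N%:E <= completion_val (x - completion_emb y))%E;
  completion_complete : forall u : nat -> completion_field,
    (forall N : int, exists n0, forall m n : nat,
       (n0 <= m)%N -> (n0 <= n)%N -> (N%:E <= completion_val (u m - u n))%E) ->
    exists l : completion_field, forall N : int, exists n0, forall n : nat,
      (n0 <= n)%N -> (N%:E <= completion_val (u n - l))%E
}.

Definition valuation_ring (K : fieldExtType rat) (P : set K)
    (C : completion P) : set C :=
  [set x | (0 <= completion_val x)%E].

Definition extended_ideal (K : fieldExtType rat) (P : set K)
    (C : completion P) : set C :=
  idealM [set completion_emb C x | x in P] (@valuation_ring K P C).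

Definition floor_function (K : fieldExtType rat) (P : set K)
    (C : completion P) (T : set K) (s : C -> K) :=
  [/\ forall x, @extended_ideal K P C (x - completion_emb C (s x)),
      forall x, exists2 t, T t & integers_outside P (t * s x),
      s 0 = 0 &
      forall x y, @extended_ideal K P C (x - y) -> s x = s y].

(* [None] once the algorithm has stopped. *)
Fixpoint complete_quotient (K : fieldExtType rat) (P : set K)
    (C : completion P) (s : C -> K) (x : C) (n : nat) : option C :=
  if n is m.+1 then
    obind (fun y : C => if y == completion_emb C (s y) then None
                        else Some (y - completion_emb C (s y))^-1)
          (complete_quotient s x m)
  else Some x.

Definition partial_quotient (K : fieldExtType rat) (P : set K)
    (C : completion P) (s : C -> K) (x : C) (n : nat) : option K :=
  omap s (complete_quotient s x n).

Definition finite_expansion (K : fieldExtType rat) (P : set K)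
    (C : completion P) (s : C -> K) (x : C) :=
  exists n, partial_quotient s x n = None.

Definition CFF_property (K : fieldExtType rat) (P : set K)
    (C : completion P) (T : set K) :=
  [/\ finite_set T, T `<=` @ring_of_integers K `\ 0 &
      exists2 s : C -> K, floor_function T s &
        forall x : K, finite_expansion s (completion_emb C x)].

(* C is R[i]; [sigma] lists the real embeddings without repetition, and [tau] lists one
   embedding out of each pair of complex conjugate ones. *)
Definition embeddings_listed (R : realType) (K : fieldExtType rat) (r1 r2 : nat)
    (sigma : 'I_r1 -> {rmorphism K -> R})
    (tau : 'I_r2 -> {rmorphism K -> R[i]}) :=
  [/\ forall i j, sigma i =1 sigma j -> i = j,
      forall i j, tau i =1 tau j \/ (forall x, tau i x = (tau j x)^*) -> i = j,
      forall i, exists x, tau i x != (tau i x)^* &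
      forall phi : {rmorphism K -> R[i]},
        (exists i, forall x, phi x = (sigma i x)%:C) \/
        (exists j, phi =1 tau j \/ (forall x, phi x = (tau j x)^*))].

Definition log_embedding (R : realType) (K : fieldExtType rat) (r1 r2 : nat)
    (sigma : 'I_r1 -> {rmorphism K -> R})
    (tau : 'I_r2 -> {rmorphism K -> R[i]}) (x : K) : 'rV[R]_(r1 + r2) :=
  row_mx (\row_i ln `|sigma i x|)
         (\row_j (2 * ln (ComplexField.Normc.normc (tau j x)))).

Definition log_unit_lattice (R : realType) (K : fieldExtType rat) (r1 r2 : nat)
    (sigma : 'I_r1 -> {rmorphism K -> R})
    (tau : 'I_r2 -> {rmorphism K -> R[i]}) : set 'rV[R]_(r1 + r2) :=
  [set log_embedding sigma tau x | x in @unit_group K].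

Definition linear_span (R : realType) (n : nat) (A : set 'rV[R]_n) :
    set 'rV[R]_n :=
  [set v | exists2 X : seq 'rV[R]_n, {in X, forall w, A w} & v \in <<X>>%VS].

(* [mx_norm] is the sup norm.  For a lattice A the infimum is a minimum and the
   supremum is finite. *)
Definition covering_radius (R : realType) (n : nat) (A : set 'rV[R]_n) : R :=
  sup [set inf [set mx_norm (v - w) | w in A] | v in linear_span A].

Definition const_cK (R : realType) (d r2 : nat) (D : int) : R :=
  Num.max (`|D|%:~R * (8 / pi ^+ 2) ^+ r2 * (d`!%:R / d%:R ^+ d)) 1.

Definition const_cMK (R : realType) (d : nat) (M : int) (eps T0 : R) : R :=
  (M%:~R /
   (eps * T0 *
    (((1 - eps ^+ d) / (eps ^+ d * T0 ^+ d) + 1) `^ (d%:R^-1) - 1))) ^+ d.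

Definition approximation_property (R : realType) (K : fieldExtType rat)
    (M : int) (eps : R) (A : set K) :=
  forall xi : K, exists a (j : int),
    [/\ A a, 0 < j < M &
        forall phi : {rmorphism K -> R[i]},
          ComplexField.Normc.normc (phi (j%:~R * xi - a)) < eps].

(* Main.v *)
(** If $\alpha$ has complete quotients $\alpha_n$ and partial quotients $a_n$, put
    $V_{-1} = \alpha$, $V_0 = 1$, $V_{n+1} = V_{n-1} - a_n V_n$, so that
    $\alpha_n = V_{n-1} / V_n$ and the expansion stops as soon as $V_n = 0$.  Multiplied
    by the product $t_0 \cdots t_{n-1}$ of the denominators of the $a_i$ and by a
    denominator of $\alpha$, $V_n$ is an integer of $K$ divisible by $P^n$: if it is not
    zero, its norm is at least $N(P)^n$.  If $|\phi(t_i a_i)| \le B_\phi$ for every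
    embedding $\phi$, the recurrence bounds the same norm by a constant times
    $(\prod_\phi (B_\phi + M))^n$, so that expansions are finite when
    $\prod_\phi (B_\phi + M) < N(P)$.

    An ideal $A = cP$ with the approximation property provides such representatives
    $a_i$ of all classes modulo $P$, with $B_\phi = \epsilon / |\phi(c)|$.  Here
    $\prod_\phi B_\phi \le \epsilon^d N(P)$ because $cP$ is integral, and after
    multiplying $c$ by a unit every $B_\phi$ is at most
    $u N(P)^{1/d}$ with $u$ as close to $\epsilon T_0$ as desired.  With
    $\delta = M / N(P)^{1/d}$ this gives
    $\prod_\phi (B_\phi + M) \le N(P) ((u + \delta)^d - u^d + \epsilon^d)$,
    and $N(P) > c(M,K)$ says that the right-hand side is less than $N(P)$ for
    $u = \epsilon T_0$.

    Adjusting $c$ by a unit requires Dirichlet's unit theorem: the logarithms of the units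
    span the trace-zero hyperplane. *)

Require Import Defs.
From HB Require Import structures.
From mathcomp Require Import all_boot all_order all_algebra all_field.
From mathcomp Require Import all_classical all_reals all_analysis.
From mathcomp Require Import finmap complex.
From mathcomp Require Import zify ring lra.
Set Implicit Arguments.
Unset Strict Implicit.
Unset Printing Implicit Defensive.
Import Order.TTheory GRing.Theory Num.Theory.
Local Open Scope classical_set_scope.
Local Open Scope ring_scope.
Import numFieldNormedType.Exports.

(** * Pigeonhole principle and the index of an integer row lattice *)

Lemma pigeonhole (T : finType) (f : nat -> T) :
  exists i j : nat, (i < j)%N /\ f i = f j.
Proof.
have /injectivePn[i [j ij fij]] : ~~ injectiveb (fun k : 'I_(#|T|.+1) => f k).
  by apply/negP => /injectiveP /leq_card; rewrite card_ord ltnn.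
case: (ltngtP i j) => [lt_ij|lt_ji|eq_ij].
- by exists i, j.
- by exists j, i.
- by move: ij; rewrite (val_inj eq_ij) eqxx.
Qed.

Lemma unitmx_int_det n (A : 'M[int]_n) : A \in unitmx -> `|\det A|%N = 1%N.
Proof.
rewrite unitmxE => /unitrP[y [y1 _]]; move: (congr1 absz y1).
by rewrite abszM => /eqP; rewrite muln_eq1 => /andP[_ /eqP].
Qed.

(* The Smith normal form turns congruence modulo the row lattice of A into
   congruences modulo the elementary divisors. *)
Lemma row_lattice_index n (A : 'M[int]_n) : \det A != 0 ->
  exists (T : finType) (code : 'rV[int]_n -> T),
    #|T| = `|\det A|%N /\
    forall u v, code u = code v -> exists w, u - v = w *m A.
Proof.
move=> detA0.
have [L uL [Q uQ [e _ AE]]] := int_Smith_normal_form A.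
set D := \matrix_(i, j) _ in AE.
have DE : D = diag_mx (\row_(i < n) e`_i).
  by apply/matrixP=> i j; rewrite !mxE.
have detD : `|\det A|%N = (\prod_(i < n) `|(e`_i)%R|)%N.
  rewrite AE !det_mulmx !abszM (unitmx_int_det uL) (unitmx_int_det uQ) mul1n muln1 DE det_diag.
  rewrite (big_morph absz abszM (erefl _ : `|1|%N = 1%N)).
  by apply: eq_bigr => i _; rewrite !mxE.
have e0 (i : 'I_n) : e`_i != 0.
  apply: contraNneq detA0 => ei0; rewrite -absz_eq0 detD.
  by rewrite (bigD1 i) //= ei0 absz0 mul0n.
have red (i : 'I_n) (z : int) : (`|(z %% e`_i)%Z| < `|(e`_i)%R|)%N.
  by have := ltz_mod z (e0 i); have := modz_ge0 z (e0 i); lia.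
exists {dffun forall i : 'I_n, 'I_(`|(e`_i)%R|)}.
exists (fun u => [ffun i => Ordinal (red i ((u *m invmx Q) ord0 i))]).
split.
  rewrite card_dep_ffun detD foldrE big_image /=.
  by apply: eq_bigr => i _; rewrite card_ord.
move=> u v /ffunP uv.
pose w := (u - v) *m invmx Q.
have wE i : (e`_i %| w ord0 i)%Z.
  rewrite /w mulmxBl !mxE -eqz_mod_dvd; apply/eqP.
  have := congr1 val (uv i); rewrite !ffunE /= => /(congr1 Posz).
  by rewrite !abszE !ger0_norm ?modz_ge0 // !mxE.
exists ((\row_i (w ord0 i %/ e`_i)%Z) *m invmx L).
rewrite AE !mulmxA mulmxKV // DE.
have -> : u - v = w *m Q by rewrite mulmxKV.
congr (_ *m Q); apply/rowP => i; rewrite mul_mx_diag.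
by rewrite mxE [X in _ = X * _]mxE [X in _ = _ * X]mxE divzK.
Qed.

(** * Integers of a number field *)

Section RingOfIntegers.
Variable K : fieldExtType rat.
Local Notation O := (@ring_of_integers K).

Lemma integers_int (m : int) : O m%:~R.
Proof. exact: mxpoly.integral_id. Qed.

Lemma numfield_int_eq0 (m : int) : (m%:~R == 0 :> K) = (m == 0).
Proof. by rewrite -(rmorph_int (in_alg K)) fmorph_eq0 intr_eq0. Qed.

Lemma integers0 : O 0. Proof. exact: mxpoly.integral0. Qed.

Lemma integers1 : O 1. Proof. exact: mxpoly.integral1. Qed.

Lemma integersD x y : O x -> O y -> O (x + y).
Proof. exact: mxpoly.integral_add. Qed.

Lemma integersB x y : O x -> O y -> O (x - y).
Proof. exact: mxpoly.integral_sub. Qed.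

Lemma integersN x : O x -> O (- x).
Proof. exact: mxpoly.integral_opp. Qed.

Lemma integersM x y : O x -> O y -> O (x * y).
Proof. exact: mxpoly.integral_mul. Qed.

Lemma integersX x n : O x -> O (x ^+ n).
Proof.
move=> Ox; elim: n => [|n IHn]; first by rewrite expr0; exact: integers1.
by rewrite exprS; exact: integersM.
Qed.

Lemma integers_sum (I : Type) (r : seq I) (F : I -> K) :
  (forall i, O (F i)) -> O (\sum_(i <- r) F i).
Proof. by move=> OF; elim/big_ind: _ => //; [exact: integers0 | exact: integersD]. Qed.

(** [x] is a root of the monic polynomial X^j - X^i - (x^j - x^i), whose coefficients are integral;
    integrality is transitive. *)
Lemma integers_pow_sub x i j : (i < j)%N -> O (x ^+ j - x ^+ i) -> O x.
Proof.
move=> ij Oij.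
apply: (@mxpoly.integral_root_monic _ _ _ x ('X^j - 'X^i - (x ^+ j - x ^+ i)%:P)).
- have -> : 'X^j - 'X^i - (x ^+ j - x ^+ i)%:P
            = 'X^j - ('X^i + (x ^+ j - x ^+ i)%:P) :> {poly K}.
    by rewrite opprD addrA.
  apply/monicP; rewrite lead_coefDl ?lead_coefXn // size_polyN size_polyXn.
  rewrite ltnS (leq_trans (size_polyD _ _)) // geq_max size_polyXn ij.
  by rewrite (leq_trans (size_polyC_leq1 _)) // (leq_ltn_trans _ ij).
- by rewrite rootE !hornerE subrr.
have O01 k l : O ((k == l :> nat)%:R) by exact: mxpoly.integral_nat.
apply/mxpoly.integral_poly => k; rewrite !coefB !coefXn coefC.
apply: integersB; first exact: integersB.
by case: eqP => _ //; exact: integers0.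
Qed.

Variable b : (\dim {:K}).-tuple K.
Hypothesis hb : integral_basis b.
Local Notation d := (\dim {:K}).

Definition combination (c : 'rV[int]_d) : K := \sum_i (c 0 i)%:~R * b`_i.

Lemma integers_combination c : O (combination c).
Proof. by case: hb => _ /(_ (combination c))[_ H]; apply: H; exists (c 0). Qed.

Lemma combination_exists x : O x -> exists c, x = combination c.
Proof.
case: hb => _ /(_ x)[+ _] => /[apply] -[c ->].
by exists (\row_i c i); apply: eq_bigr => i _; rewrite mxE.
Qed.

Lemma combinationB u v : combination (u - v) = combination u - combination v.
Proof.
by rewrite -sumrB; apply: eq_bigr => i _; rewrite !mxE rmorphB mulrBl.
Qed.

Lemma combinationZ m u : combination (m *: u) = m%:~R * combination u.
Proof.
by rewrite mulr_sumr; apply: eq_bigr => i _; rewrite !mxE rmorphM mulrA.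
Qed.

Lemma rat_combination_eq0 (k : 'I_d -> rat) :
  \sum_i k i *: b`_i = 0 -> forall i, k i = 0.
Proof. by case: hb => /andP[_ /freeP H] _; apply: H. Qed.

Lemma combination_eq0 u : combination u = 0 -> u = 0.
Proof.
move=> u0; apply/rowP => i; rewrite mxE.
have /rat_combination_eq0/(_ i)/eqP : \sum_i (u 0 i)%:~R *: b`_i = 0.
  rewrite -[RHS]u0 /combination; apply: eq_bigr => j _.
  by rewrite scaler_int mulrzl.
by rewrite intr_eq0 => /eqP.
Qed.

(** Row convention: the coordinates of the elements of x O form the row lattice of [A], so that for
    nonzero x the number of residues modulo x is |det A|. *)
Definition mult_matrix (x : K) (A : 'M[int]_d) :=
  forall i : 'I_d, x * b`_i = combination (row i A).

Lemma combination_delta (i : 'I_d) : combination (delta_mx 0 i) = b`_i.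
Proof.
rewrite /combination (bigD1 i) //= mxE !eqxx mul1r big1 ?addr0 // => j ji.
by rewrite mxE (negPf ji) andbF mul0r.
Qed.

Lemma mult_matrix_exists x : O x -> exists A, mult_matrix x A.
Proof.
move=> Ox.
have bO (i : 'I_d) : exists c, x * b`_i = combination c.
  apply: combination_exists; apply: integersM => //.
  by rewrite -combination_delta; exact: integers_combination.
have [c cE] := choice bO.
by exists (\matrix_(i, j) c i 0 j) => i; rewrite cE; apply: eq_bigr => j _; rewrite !mxE.
Qed.

Lemma mult_matrixE x A w : mult_matrix x A ->
  combination (w *m A) = x * combination w.
Proof.
move=> xA; rewrite mulr_sumr.
under [RHS]eq_bigr => i _.
  rewrite mulrCA xA /combination mulr_sumr.
  over.
rewrite exchange_big /=; apply: eq_bigr => j _.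
rewrite mxE rmorph_sum mulr_suml; apply: eq_bigr => i _.
by rewrite rmorphM -mulrA mxE.
Qed.

Lemma mult_matrix_det_neq0 x A : x != 0 -> mult_matrix x A -> \det A != 0.
Proof.
move=> x0 xA; apply/negP => /det0P[v v0 vA].
have /eqP := mult_matrixE v xA.
rewrite vA (_ : combination 0 = 0); last first.
  by apply: big1 => i _; rewrite mxE mul0r.
rewrite eq_sym mulf_eq0 (negPf x0) /= => /eqP/combination_eq0/eqP.
by rewrite (negPf v0).
Qed.

(** If u holds the coordinates of 1, then u adj(A) holds those of det(A) / x, because u adj(A) A =
    det(A) u. *)
Lemma det_div_integer x A : x != 0 -> mult_matrix x A ->
  O ((\det A)%:~R / x).
Proof.
move=> x0 xA; have [u uE] := combination_exists integers1.
have := mult_matrixE (u *m \adj A) xA.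
rewrite -mulmxA mul_adj_mx mul_mx_scalar combinationZ -uE mulr1 => ->.
by rewrite mulrAC mulfV // mul1r; exact: integers_combination.
Qed.

(** [T] plays the part of O / x O: by [mult_matrixE] a vector of the row lattice of [A] gives a
    multiple of x, and this lattice has index |det A|. [coords] falls back on 0 only outside O. *)
Lemma residue_code x A : x != 0 -> mult_matrix x A ->
  exists (T : finType) (code : K -> T), #|T| = `|\det A|%N /\
    forall u v, O u -> O v -> code u = code v -> O ((u - v) / x).
Proof.
move=> x0 xA.
have [T [code [cT codeP]]] := row_lattice_index (mult_matrix_det_neq0 x0 xA).
pose coords u := xget 0 [set c | u = combination c].
have coordsE u : O u -> u = combination (coords u).
  by move=> /combination_exists/cid[c uc]; rewrite /coords; case: xgetP => [//|/(_ c)].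
exists T, (code \o coords); split=> // u v Ou Ov /codeP[w uvw].
rewrite (coordsE u) // (coordsE v) // -combinationB uvw (mult_matrixE _ xA).
by rewrite mulrAC mulfV // mul1r; exact: integers_combination.
Qed.

Lemma integer_pigeonhole x (f : nat -> K) : O x -> x != 0 ->
  (forall n, O (f n)) -> exists i j, (i < j)%N /\ O ((f j - f i) / x).
Proof.
move=> Ox x0 Of; have [A xA] := mult_matrix_exists Ox.
have [T [code [_ codeP]]] := residue_code x0 xA.
have [i [j [ij eij]]] := pigeonhole (code \o f).
by exists i, j; split => //; apply: codeP.
Qed.

(** Two of the numbers a x^n agree modulo a, so x^j - x^i is an integer for some i < j and
    [integers_pow_sub] applies. *)
Lemma integers_bounded_powers a x : O a -> a != 0 ->
  (forall n, O (a * x ^+ n)) -> O x.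
Proof.
move=> Oa a0 Oax.
have [i [j [ij]]] := integer_pigeonhole Oa a0 Oax.
by rewrite -mulrBr mulrAC mulfV // mul1r; exact: integers_pow_sub.
Qed.

Lemma integers_denominator x : exists2 m : int, m != 0 & O (m%:~R * x).
Proof.
case: hb => /andP[/eqP bspan _] _.
have xb : x \in <<b>>%VS by rewrite bspan memvf.
pose m : int := \prod_i denq (coord b i x).
have m0 : m != 0 by apply/prodf_neq0 => i _; exact: denq_neq0.
exists m => //; rewrite (coord_span xb) mulr_sumr; apply: integers_sum => i.
have -> : m%:~R * (coord b i x *: b`_i)
   = ((\prod_(j | j != i) denq (coord b j x)) * numq (coord b i x))%:~R * b`_i.
  rewrite !mulrzl -!scaler_int scalerA; congr (_ *: _).
  by rewrite /m (bigD1 i) //= !intrM numqE; ring.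
apply: integersM; first exact: integers_int.
by rewrite -combination_delta; exact: integers_combination.
Qed.

(** If x and y divide n and are congruent modulo n, they divide each other: x / y = 1 + ((x - y) /
    n) (n / y). This is how units are produced. *)
Lemma unit_group_of_congruent (n x y : K) : x != 0 -> y != 0 ->
  O (n / x) -> O (n / y) -> O ((x - y) / n) -> n != 0 -> unit_group (x / y).
Proof.
have aux z t : t != 0 -> n != 0 -> O (n / t) -> O ((z - t) / n) -> O (z / t).
  move=> t0 n0 Ot Ozt; have -> : z / t = 1 + (z - t) / n * (n / t).
    by field; rewrite n0 t0.
  by apply: integersD; [exact: integers1 | exact: integersM].
move=> x0 y0 Ox Oy Oxy n0; split; first by rewrite mulf_neq0 ?invr_eq0.
  exact: aux.
rewrite invf_div; apply: aux => //.
by rewrite -opprB mulNr; exact: integersN.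
Qed.

End RingOfIntegers.

(** * Embeddings and norms *)

(** Primitive element theorem: in characteristic 0 the extension is separable, hence generated by
    one [theta], and [q] is its minimal polynomial over the rationals. *)
Lemma primitive_polynomial (K : fieldExtType rat) :
  exists (theta : K) (q : {poly rat}),
    [/\ size q = (\dim {:K}).+1, separable_poly q,
        forall y : K, exists f : {poly rat}, y = (map_poly (in_alg K) f).[theta] &
        forall f : {poly rat}, root (map_poly (in_alg K) f) theta = (q %| f)].
Proof.
have char0 : has_pchar0 K by move=> p; rewrite pchar_lalg pchar_num.
have sepK : separable 1%AS {:K}%AS.
  by apply/separableP => y _; exact: pcharf0_separable.
have KE := eq_adjoin_separable_generator sepK (sub1v _).
set theta := separable_generator _ _ in KE.
have /polyOver1P[q qE] := minPolyOver 1%AS theta.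
have root_min : root (map_poly (in_alg K) q) theta by rewrite -qE root_minPoly.
exists theta, q; split.
- rewrite -(size_map_poly (in_alg K)) -qE size_minPoly adjoin_degreeE -KE.
  by rewrite dimv1 divn1.
- rewrite -(separable_map (in_alg K)) -qE.
  exact: (@pcharf0_separable _ K 1%AS char0 theta).
- move=> y.
  have /polyOver1P[f fE] := Fadjoin_polyOver 1%AS theta y.
  by exists f; rewrite -fE Fadjoin_poly_eq // -KE memvf.
- move=> f; apply/idP/idP => [ft|/dvdpP[g ->]].
    rewrite -(dvdp_map (in_alg K)) -qE minPoly_dvdp //.
    by apply/polyOver1P; exists f.
  by rewrite rmorphM rootM root_min orbT.
Qed.

Section Embeddings.
Variables (R : realType) (K : fieldExtType rat).
Local Notation C := R[i].
Local Notation d := (\dim {:K}).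

Lemma embedding_poly (phi : {rmorphism K -> C}) (f : {poly rat}) (y : K) :
  phi (map_poly (in_alg K) f).[y] = (map_poly ratr f).[phi y].
Proof.
rewrite -horner_map -map_poly_comp; congr (_.[_]).
by apply: eq_map_poly => a /=; rewrite rmorphZ_num rmorph1 mulr1.
Qed.

(** Write y as f(theta) and send it to f(rho). This is well defined and a ring morphism, because two
    choices of f differ by a multiple of q, which vanishes at rho. *)
Lemma embedding_of_root (theta : K) (q : {poly rat}) (rho : C) :
  (forall y : K, exists f : {poly rat}, y = (map_poly (in_alg K) f).[theta]) ->
  (forall f : {poly rat}, root (map_poly (in_alg K) f) theta = (q %| f)) ->
  root (map_poly ratr q) rho ->
  exists phi : {rmorphism K -> C}, phi theta = rho.
Proof.
move=> gen minq qrho.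
have [F FE] := choice gen.
pose psi y := (map_poly ratr (F y)).[rho].
have psiE f y : (map_poly (in_alg K) f).[theta] = y ->
    psi y = (map_poly ratr f).[rho].
  move=> fy; apply/eqP; rewrite /psi -subr_eq0 -hornerN -hornerD -rmorphB -rootE.
  have : q %| F y - f by rewrite -minq rootE rmorphB hornerD hornerN fy -FE subrr.
  by move=> /dvdpP[g ->]; rewrite rmorphM rootM qrho orbT.
have psiB : zmod_morphism psi.
  move=> y z; rewrite (psiE (F y - F z)) ?rmorphB ?hornerD ?hornerN //.
  by rewrite -!FE.
have psiM : monoid_morphism psi.
  split; first by rewrite (psiE 1) ?rmorph1 ?hornerC.
  move=> y z; rewrite (psiE (F y * F z)) ?rmorphM ?hornerM //.
  by rewrite -!FE.
pose psiA := GRing.isZmodMorphism.Build K C psi psiB.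
pose psiR := GRing.isMonoidMorphism.Build K C psi psiM.
pose phi : {rmorphism K -> C} := HB.pack psi psiA psiR.
exists phi; rewrite /= (psiE 'X) ?map_polyX ?hornerX //.
Qed.

Variables (r1 r2 : nat) (sigma : 'I_r1 -> {rmorphism K -> R})
  (tau : 'I_r2 -> {rmorphism K -> C}).
Hypothesis hemb : embeddings_listed sigma tau.

Definition embedding_index : finType := ('I_r1 + ('I_r2 + 'I_r2))%type.

Definition embedding (e : embedding_index) : {rmorphism K -> C} :=
  match e with
  | inl i => real_complex R \o sigma i
  | inr (inl j) => tau j
  | inr (inr j) => @conjc R \o tau j
  end.

Lemma embedding_inj e e' : embedding e =1 embedding e' -> e = e'.
Proof.
case: hemb => sig_inj tau_inj tau_cpx _.
have sig_tau i j : ~ (forall x, (sigma i x)%:C%C = tau j x).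
  by move=> st; have [x] := tau_cpx j; rewrite -st conjc_real eqxx.
have sig_ctau i j : ~ (forall x, (sigma i x)%:C%C = (tau j x)^*%C).
  by move=> st; have [x] := tau_cpx j; rewrite -st -[tau j x]conjcK -st conjc_real eqxx.
have tau_ctau i j : ~ (forall x, tau i x = (tau j x)^*%C).
  move=> tt; have ij := tau_inj i j (or_intror tt).
  by have [x] := tau_cpx j; rewrite -tt ij eqxx.
case: e => [i|[i|i]]; case: e' => [j|[j|j]] /= ee.
- by congr inl; apply: sig_inj => x; apply: (@complexI R); exact: ee.
- by case: (sig_tau i j).
- by case: (sig_ctau i j).
- by case: (sig_tau j i) => x; exact: (esym (ee x)).
- by congr (inr (inl _)); apply: tau_inj; left.
- by case: (tau_ctau i j).
- by case: (sig_ctau j i) => x; exact: (esym (ee x)).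
- by case: (tau_ctau j i) => x; exact: (esym (ee x)).
- congr (inr (inr _)); apply: tau_inj; left => x.
  by apply: (inv_inj (@conjcK R)); exact: ee.
Qed.

Lemma embedding_surj (phi : {rmorphism K -> C}) : exists e, phi =1 embedding e.
Proof.
case: hemb => _ _ _ /(_ phi)[[i iE]|[j [jE|jE]]].
- by exists (inl i).
- by exists (inr (inl j)).
- by exists (inr (inr j)).
Qed.

(** Evaluation at [theta] identifies the embeddings with the complex roots of the minimal
    polynomial, which is separable of degree d. *)
Lemma primitive_embeddings : exists theta : K,
  injective (fun e => embedding e theta) /\ #|embedding_index| = d /\
  forall y : K, exists f : {poly rat}, y = (map_poly (in_alg K) f).[theta] /\ (size f <= d)%N.
Proof.
have [theta [q [sq sepq gen minq]]] := primitive_polynomial K.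
have inj : injective (fun e => embedding e theta).
  move=> e e' ee; apply: embedding_inj => y.
  by have [f ->] := gen y; rewrite !embedding_poly ee.
exists theta; split => //; split; last first.
  move=> y; have [f fE] := gen y; exists (f %% q); split; last first.
    by rewrite -ltnS -sq ltn_modp -size_poly_gt0 sq.
  rewrite fE [in LHS](divp_eq f q) rmorphD rmorphM hornerD hornerM.
  have /eqP -> : root (map_poly (in_alg K) q) theta by rewrite minq.
  by rewrite mulr0 add0r.
have [s sE] := closed_field_poly_normal (map_poly ratr q : {poly C}).
have q0 : q != 0 by rewrite -size_poly_gt0 sq.
have lc0 : lead_coef (map_poly ratr q : {poly C}) != 0.
  by rewrite lead_coef_eq0 map_poly_eq0.
have size_s : size s = d.
  have := congr1 (fun p : {poly C} => size p) sE.
  by rewrite size_map_poly sq size_scale // size_prod_XsubC => -[].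
have uniq_s : uniq s.
  rewrite -separable_prod_XsubC -(eqp_separable (_ : map_poly ratr q %= _)).
    by rewrite separable_map.
  by rewrite sE eqp_scale.
have mem_s rho : (rho \in s) = root (map_poly ratr q) rho.
  by rewrite sE rootZ // root_prod_XsubC.
rewrite -size_s cardE -(size_map (fun e => embedding e theta)).
apply: perm_size; apply: uniq_perm => //.
  by rewrite map_inj_uniq ?enum_uniq.
move=> rho; rewrite mem_s; apply/mapP/idP => [[e _ ->]|].
  rewrite rootE -embedding_poly.
  have /eqP -> : root (map_poly (in_alg K) q) theta by rewrite minq.
  by rewrite rmorph0.
move=> /(embedding_of_root gen minq)[phi phirho].
have [e eE] := embedding_surj phi.
by exists e; rewrite ?mem_enum // -eE phirho.
Qed.

Lemma card_embedding_index : #|embedding_index| = d.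
Proof. by have [theta [_ []]] := primitive_embeddings. Qed.

Variable b : d.-tuple K.
Hypothesis hb : integral_basis b.

(** Multiplying by the matrix of coordinates of 1, theta, ..., theta^(d-1) gives a transposed
    Vandermonde matrix with distinct nodes. *)
Lemma embedding_matrix_unit (g : 'I_d -> embedding_index) : injective g ->
  \det (\matrix_(i < d, j < d) embedding (g i) b`_j) != 0.
Proof.
move=> ginj; have [theta [inj [_ gen]]] := primitive_embeddings.
set F := \matrix_(i, j) _.
pose B := \matrix_(i < d, j < d) (ratr (coord b i (theta ^+ j)) : C).
have FB : F *m B = (Vandermonde d (\row_i embedding (g i) theta))^T.
  apply/matrixP => i j; rewrite !mxE -rmorphXn.
  have : theta ^+ j \in <<b>>%VS by case: hb => /andP[/eqP -> _] _; rewrite memvf.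
  move=> /coord_span ->; rewrite rmorph_sum; apply: eq_bigr => k _.
  by rewrite !mxE rmorphZ_num mulrC.
have : \det (F *m B) != 0.
  rewrite FB det_tr det_Vandermonde.
  apply/prodf_neq0 => i _; apply/prodf_neq0 => j ij.
  rewrite !mxE subr_eq0; apply: contraTneq ij => /inj/ginj ->.
  by rewrite ltnn.
by rewrite det_mulmx mulf_eq0 negb_or => /andP[].
Qed.

(** The embedding matrix F diagonalizes multiplication by x: diag(phi(x)) F = F A^T, and det F is
    nonzero. *)
Lemma mult_matrix_det (x : K) (A : 'M[int]_d) : mult_matrix b x A ->
  \prod_e embedding e x = (\det A)%:~R.
Proof.
move=> xA.
have card_d := card_embedding_index.
pose g (i : 'I_d) := enum_val (cast_ord (esym card_d) i).
have ginj : injective g by move=> i j /enum_val_inj/cast_ord_inj.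
have gbij : bijective g.
  by apply: inj_card_bij ginj _; rewrite card_ord card_d.
have := embedding_matrix_unit ginj.
set F := \matrix_(i, j) _ => F0.
have : diag_mx (\row_i embedding (g i) x) *m F = F *m (map_mx intr A)^T.
  apply/matrixP => i j; rewrite mul_diag_mx !mxE -rmorphM xA rmorph_sum.
  by apply: eq_bigr => k _; rewrite !mxE rmorphM rmorph_int mulrC.
move=> /(congr1 determinant); rewrite !det_mulmx det_diag det_tr det_map_mx mulrC.
move=> /(mulfI F0) <-; rewrite (reindex g) /=; last exact: onW_bij.
by apply: eq_bigr => i _; rewrite mxE.
Qed.

Local Notation normc := (@ComplexField.Normc.normc R).

(** The absolute value of the field norm of x; see [place_norm_det]. *)
Definition place_norm (x : K) : R := \prod_e normc (embedding e x).

Lemma normc_int (m : int) : normc m%:~R = `|m|%:~R.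
Proof.
apply: (@complexI R); rewrite -[LHS]/(`|m%:~R : C|) -intr_norm.
by rewrite -[RHS]/(real_complex R _) rmorph_int.
Qed.

Lemma place_norm_det x A : mult_matrix b x A -> place_norm x = `|\det A|%:~R.
Proof.
move=> /mult_matrix_det xA; rewrite -normc_int -xA.
by rewrite (big_morph normc (@ComplexField.Normc.normcM R) (@ComplexField.Normc.normc1 R)).
Qed.

Lemma place_normM x y : place_norm (x * y) = place_norm x * place_norm y.
Proof.
rewrite -big_split; apply: eq_bigr => e _ /=.
by rewrite rmorphM ComplexField.Normc.normcM.
Qed.

Lemma normc_ge0 (z : C) : 0 <= normc z.
Proof. by case: z => a c; rewrite /= sqrtr_ge0. Qed.

Lemma normc_gt0 (z : C) : z != 0 -> 0 < normc z.
Proof.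
move=> z0; rewrite lt_neqAle normc_ge0 andbT eq_sym.
by apply: contra_neq z0; exact: ComplexField.Normc.eq0_normc.
Qed.

Lemma embedding_norm_gt0 (phi : {rmorphism K -> C}) x : x != 0 -> 0 < normc (phi x).
Proof. by move=> x0; apply: normc_gt0; rewrite fmorph_eq0. Qed.

Lemma place_norm_gt0 x : x != 0 -> 0 < place_norm x.
Proof. by move=> x0; apply: prodr_gt0 => e _; exact: embedding_norm_gt0. Qed.

Lemma place_norm_int (m : int) : place_norm m%:~R = `|m|%:~R ^+ d.
Proof.
rewrite -card_embedding_index -prodr_const; apply: eq_bigr => e _.
by rewrite rmorph_int normc_int.
Qed.

Lemma place_norm_ge1 x : ring_of_integers x -> x != 0 -> 1 <= place_norm x.
Proof.
move=> Ox x0; have [A xA] := mult_matrix_exists hb Ox.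
have := mult_matrix_det_neq0 hb x0 xA; rewrite (place_norm_det xA) => detA.
by rewrite ler1z -gtz0_ge1 normr_gt0.
Qed.

Lemma place_norm_code x : ring_of_integers x -> x != 0 ->
  exists (T : finType) (code : K -> T), #|T|%:R = place_norm x /\
    forall u v, ring_of_integers u -> ring_of_integers v -> code u = code v ->
      ring_of_integers ((u - v) / x).
Proof.
move=> Ox x0; have [A xA] := mult_matrix_exists hb Ox.
have [T [code [cT codeP]]] := residue_code hb x0 xA.
by exists T, code; split => //; rewrite (place_norm_det xA) cT -abszE.
Qed.

Lemma place_norm_div x : ring_of_integers x -> x != 0 ->
  exists m : nat, place_norm x = m%:R /\ ring_of_integers (m%:R / x).
Proof.
move=> Ox x0; have [A xA] := mult_matrix_exists hb Ox.
exists `|\det A|%N; split; first by rewrite (place_norm_det xA) -abszE.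
have := det_div_integer hb x0 xA.
case: (intP (\det A)) => [|n|n]; rewrite ?abszN /= ?mulr0z // ?mulrNz ?mulNr //.
by move=> /integersN; rewrite opprK.
Qed.

End Embeddings.

(** * Unit theorem *)

(** A pigeonhole form of Minkowski's theorem on linear forms. Among the (H+1)^n points with
    coordinates in {0,...,H}, two have values in the same cell of a grid with sides [y i]; their
    difference is the required vector. *)
Lemma linear_forms_small_values (R : realType) (I : finType) (n : nat)
    (l : I -> 'I_n -> R) : (0 < n)%N -> #|I| = n ->
  exists2 c : R, 0 < c & forall y : I -> R, (forall i, 0 < y i) ->
    c <= \prod_i y i ->
    exists2 x : 'rV[int]_n, x != 0 &
      forall i, `|\sum_k (x 0 k)%:~R * l i k| <= y i.
Proof.
move=> n0 cardI.
pose L : R := 1 + \sum_i \sum_k `|l i k|.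
have L1 : 1 <= L.
  by rewrite lerDl; apply: sumr_ge0 => i _; apply: sumr_ge0.
have L0 : 0 < L by exact: lt_le_trans L1.
exists ((4 * L) ^+ n); first by rewrite exprn_gt0 // mulr_gt0.
move=> y y0 cy.
(* H exceeds every y_i, so each 2 L H / y_i is at least 1 and adding 1 to its integer part at most
   doubles it. The number of cells is then at most (4 L H)^n / prod y_i <= H^n. *)
pose H := (Num.truncn (\sum_i y i)).+1.
have yH i : y i <= 2 * L * H%:R.
  have yS : y i <= \sum_i y i.
    by rewrite (bigD1 i) //= lerDl; apply: sumr_ge0 => j _; exact: ltW.
  apply: (le_trans yS); apply: (le_trans (ltW (truncnS_gt _))).
  by rewrite -[leLHS]mul1r ler_wpM2r // -[leLHS]mul1r ler_pM // ler1n.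
pose val (p : {ffun 'I_n -> 'I_H.+1}) i := \sum_k (p k)%:R * l i k.
have val_bound p i : `|val p i| <= L * H%:R.
  apply: (le_trans (ler_norm_sum _ _ _)).
  apply: (@le_trans _ _ (\sum_k `|l i k| * H%:R)).
    apply: ler_sum => k _; rewrite normrM mulrC normr_nat ler_wpM2l //.
    by rewrite ler_nat -ltnS.
  rewrite -mulr_suml ler_wpM2r // /L (bigD1 i) //= addrCA lerDl addr_ge0 //.
  by apply: sumr_ge0 => j _; apply: sumr_ge0.
pose N i := Num.truncn (2 * L * H%:R / y i).
have box_lt p i : (Num.truncn ((val p i + L * H%:R) / y i) < (N i).+1)%N.
  rewrite ltnS; apply: le_truncn; rewrite ler_pM2r ?invr_gt0 //.
  by have := val_bound p i; rewrite ler_norml => /andP[_]; lra.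
pose box p : {dffun forall i, 'I_(N i).+1} := [ffun i => Ordinal (box_lt p i)].
have /injectivePn[p [q pq boxpq]] : ~~ injectiveb box.
  apply/negP => /injectiveP/leq_card.
  rewrite card_ffun card_dep_ffun foldrE big_image /= !card_ord leqNgt.
  move=> /negP; apply.
  rewrite -(ltr_nat R) natr_prod natrX.
  apply: (@le_lt_trans _ _ (\prod_i (4 * L * H%:R / y i))).
    apply: ler_prod => i _; rewrite card_ord ler0n /= -natr1.
    have /andP[+ _] : (N i)%:R <= 2 * L * H%:R / y i < (N i).+1%:R.
      by apply: truncn_itv; rewrite divr_ge0 ?mulr_ge0 // ltW.
    have : 1 <= 2 * L * H%:R / y i by rewrite ler_pdivlMr // mul1r.
    have -> : 4 * L * H%:R / y i = 2 * L * H%:R / y i + 2 * L * H%:R / y i by ring.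
    by move=> h1 h2; rewrite addrC lerD.
  rewrite prodf_div prodr_const cardI exprMn.
  apply: (@le_lt_trans _ _ (H%:R ^+ n)).
    rewrite ler_pdivrMr ?prodr_gt0 // mulrC ler_wpM2l // exprn_ge0 //.
  by rewrite ltrXn2r // ?ltr_nat // -?lt0n.
exists (\row_k ((p k)%:Z - (q k)%:Z)).
  apply: contra_neq pq => /rowP x0; apply/ffunP => k; apply/val_inj.
  by have := x0 k; rewrite !mxE => /eqP; rewrite subr_eq0 => /eqP[].
move=> i.
have -> : \sum_k ((\row_k ((p k)%:Z - (q k)%:Z)) 0 k)%:~R * l i k = val p i - val q i.
  by rewrite -sumrB; apply: eq_bigr => k _; rewrite mxE rmorphB mulrBl /=.
have := congr1 (fun f : {dffun forall i, 'I_(N i).+1} => nat_of_ord (f i)) boxpq.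
rewrite /box !ffunE /=.
have tr z : - (L * H%:R) <= z -> let t := Num.truncn ((z + L * H%:R) / y i) in
    t%:R * y i <= z + L * H%:R < t.+1%:R * y i.
  move=> zL /=; rewrite -ler_pdivlMr // -ltr_pdivrMr //; apply: truncn_itv.
  by rewrite divr_ge0 ?(ltW (y0 _)) //; move: zL; lra.
have /andP[/tr/= p1 _] : - (L * H%:R) <= val p i <= L * H%:R by rewrite -ler_norml.
have /andP[/tr/= q1 _] : - (L * H%:R) <= val q i <= L * H%:R by rewrite -ler_norml.
move=> e; move: p1 q1; rewrite e.
set t := Num.truncn _; rewrite -(natr1 t) (mulrDl t%:R) mul1r ler_norml.
set ty := t%:R * y i; move=> /andP[a1 a2] /andP[a3 a4]; by apply/andP; split; lra.
Qed.

(** * Subgroups of R^n and their covering radius *)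

Section CoveringRadius.
Variables (R : realType) (n : nat).
Local Notation V := 'rV[R]_n.

(** The spans of finite parts of A have bounded dimension, and a part whose span has maximal
    dimension already spans A. *)
Lemma finite_spanning_subset (A : set V) :
  exists2 X : seq V, {in X, forall w, A w} & forall w, A w -> w \in <<X>>%VS.
Proof.
pose P k := `[< exists2 X : seq V, {in X, forall w, A w} & \dim <<X>> = k >].
have P0 : exists k, P k.
  by exists 0%N; apply/asboolP; exists [::]; rewrite ?span_nil ?dimv0.
have Pub k : P k -> (k <= \dim {:V})%N.
  by move=> /asboolP[X _ <-]; exact: dimvS (subvf _).
case: (ex_maxnP P0 Pub) => k /asboolP[Y YA dimY] kmax.
exists Y => // w Aw; apply: contraT => wY.
suff : (k.+1 <= k)%N by rewrite ltnn.
apply: kmax; apply/asboolP; exists (w :: Y).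
  by move=> z; rewrite inE => /predU1P[->|/YA].
have w0 : w != 0 by apply: contraNneq wY => ->; rewrite mem0v.
rewrite span_cons dimv_disjoint_sum; last first.
  apply/eqP; rewrite -subv0; apply/subvP => z; rewrite memv_cap => /andP[].
  move=> /vlineP[c ->]; rewrite rpredZeq (negPf wY) orbF => /eqP ->.
  by rewrite scale0r mem0v.
by rewrite dim_vline w0 dimY.
Qed.

(** Some column of the cokernel matrix of X does not vanish on v. *)
Lemma separating_functional (X : seq V) (v : V) : v \notin <<X>>%VS ->
  exists2 g : 'cV[R]_n, {in X, forall w, w *m g = 0} & v *m g != 0.
Proof.
move=> vX.
pose M := \matrix_(i < size X) X`_i.
have : ~~ (v <= M)%MS.
  apply: contra vX => /submxP[D ->]; rewrite mulmx_sum_row memv_suml // => i _.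
  by rewrite memvZ // rowK memv_span // mem_nth.
rewrite submxE => /matrix0Pn[i [j vij]].
exists (col j (cokermx M)).
  move=> w /(nthP 0)[k kX <-].
  have wC : X`_k *m cokermx M = 0.
    have -> : X`_k = row (Ordinal kX) M by rewrite rowK.
    by rewrite -row_mul mulmx_coker row0.
  by rewrite colE mulmxA wC mul0mx.
apply/matrix0Pn; by exists i, 0; rewrite colE mulmxA -colE mxE.
Qed.

Lemma mx_entry_le_norm (v : V) i : `|v 0 i| <= mx_norm v.
Proof. by rewrite mx_normrE; apply/bigmax_geP; right; exists (0, i). Qed.

Lemma mx_norm_ge0 (v : V) : 0 <= mx_norm v.
Proof. by rewrite mx_normE. Qed.

Variable A : set V.
Hypothesis A0 : A 0.
Hypothesis AB : forall u v, A u -> A v -> A (u - v).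

Let AN u : A u -> A (- u).
Proof. by rewrite -[- u]sub0r; exact: AB. Qed.

Let AD u v : A u -> A v -> A (u + v).
Proof. by move=> Au /AN; rewrite -{2}[v]opprK; exact: AB. Qed.

Let AZ (m : int) u : A u -> A (m%:~R *: u).
Proof.
move=> Au; have An (k : nat) : A (k%:R *: u).
  elim: k => [|k IHk]; first by rewrite scale0r.
  by rewrite -natr1 scalerDl scale1r; exact: AD.
case: (intP m) => [|k|k]; first by rewrite scale0r.
  exact: An.
by rewrite mulrNz scaleNr; apply: AN; exact: An.
Qed.

(** Round down the coordinates on a finite spanning part of A; each rounding costs at most the norm
    of one generator. *)
Lemma distance_to_lattice_bounded :
  exists B : R, forall v, linear_span A v ->
    exists2 w, A w & mx_norm (v - w) <= B.
Proof.
have [X XA spanX] := finite_spanning_subset A.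
exists (\sum_(x <- X) mx_norm x) => v [Y YA vY].
have {Y YA vY} vX : v \in <<in_tuple X>>%VS.
  by apply: subvP vY; apply/span_subvP => w /YA; exact: spanX.
pose c i := coord (in_tuple X) i v.
exists (\sum_(i < size X) (Num.floor (c i))%:~R *: X`_i).
  elim/big_ind: _ => // i _; apply: AZ; apply: XA; exact: mem_nth.
rewrite {1}(coord_span vX) -sumrB (big_nth 0) big_mkord.
elim/big_ind2: _ => [|x1 x2 y1 y2 h1 h2|i _].
- by rewrite mx_norm0.
- exact: le_trans (ler_mx_norm_add _ _) (lerD h1 h2).
rewrite -scalerBl.
have -> (a : R) (u : V) : mx_norm (a *: u) = `|a| * mx_norm u by exact: mx_normZ.
rewrite -[leRHS]mul1r ler_wpM2r ?mx_norm_ge0 //.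
have /andP[h1 h2] := floor_itv (c i).
by rewrite ger0_norm ?subr_ge0 // lerBlDr addrC -intrD1 ltW.
Qed.

Lemma covering_radius_ge0 : 0 <= covering_radius A.
Proof.
rewrite /covering_radius; have [[_ ub]|/sup_out ->//] := pselect (has_sup
  [set inf [set mx_norm (v - w) | w in A] | v in linear_span A]).
apply: (@le_trans _ _ (inf [set mx_norm (0 - w) | w in A])).
  apply: lb_le_inf; first by exists (mx_norm (0 - 0 : V)); exists 0.
  by move=> _ [w _ <-]; exact: mx_norm_ge0.
apply: ub_le_sup => //; exists 0 => //.
by exists [::] => //; rewrite mem0v.
Qed.

(** [eta] pays for replacing the infimum by an actual distance. The uniform bound of
    [distance_to_lattice_bounded] makes the supremum finite, hence at least the infimum at v. *)
Lemma covering_radius_approx (v : V) (eta : R) : 0 < eta -> linear_span A v ->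
  exists2 w, A w & mx_norm (v - w) < covering_radius A + eta.
Proof.
move=> eta0 Av.
have inf_ok u : has_inf [set mx_norm (u - w) | w in A].
  split; first by exists (mx_norm (u - 0)); exists 0.
  by exists 0 => _ [w _ <-]; exact: mx_norm_ge0.
have [_ [w Aw <-] wv] := inf_adherent eta0 (inf_ok v).
exists w => //; apply: (lt_le_trans wv); rewrite lerD2r.
have [B BP] := distance_to_lattice_bounded.
apply: ub_le_sup; last by exists v.
exists B => _ [u Au <-]; have [z Az zB] := BP _ Au.
apply: le_trans zB; apply: ge_inf; last by exists z.
by have [] := inf_ok u.
Qed.

End CoveringRadius.

(** * Logarithms of integers and of units *)

Lemma ln_prod (R : realType) (I : finType) (F : I -> R) : (forall i, 0 < F i) ->
  ln (\prod_i F i) = \sum_i ln (F i).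
Proof.
move=> F0; suff [_ ->] : 0 < \prod_i F i /\ ln (\prod_i F i) = \sum_i ln (F i) by [].
elim/big_rec2: _ => [|i x y _ [y0 yx]]; first by rewrite ln1.
by rewrite mulr_gt0 // lnM ?posrE // yx.
Qed.

Section UnitTheorem.
Variables (R : realType) (K : fieldExtType rat) (r1 r2 : nat).
Variables (sigma : 'I_r1 -> {rmorphism K -> R}) (tau : 'I_r2 -> {rmorphism K -> R[i]}).
Hypothesis hemb : embeddings_listed sigma tau.
Local Notation d := (\dim {:K}).
Variable b : d.-tuple K.
Hypothesis hb : integral_basis b.
Local Notation normc := (@ComplexField.Normc.normc R).
Local Notation O := (@ring_of_integers K).
Local Notation Lg := (log_embedding sigma tau).
Local Notation nrm := (place_norm sigma tau).

Lemma normc_real (x : R) : normc x%:C%C = `|x|.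
Proof. by rewrite /= expr0n addr0 sqrtr_sqr. Qed.

Lemma normc_conj (z : R[i]) : normc (z^*)%C = normc z.
Proof. by case: z => u v; rewrite /= sqrrN. Qed.

Lemma normc_embedding_real i x :
  normc (embedding sigma tau (inl i) x) = `|sigma i x|.
Proof. exact: normc_real. Qed.

Lemma normc_embedding_conj j x :
  normc (embedding sigma tau (inr (inr j)) x) = normc (tau j x).
Proof. exact: normc_conj. Qed.

Lemma normc_le_Re_Im (z : R[i]) : normc z <= `|complex.Re z| + `|complex.Im z|.
Proof.
case: z => u v /=; rewrite -[leRHS]ger0_norm ?addr_ge0 // -sqrtr_sqr ler_sqrt ?sqr_ge0 //.
rewrite sqrrD !real_normK ?num_real // -addrA lerD2l lerDr.
by rewrite mulrn_wge0 // mulr_ge0.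
Qed.

Lemma log_real x i : Lg x 0 (lshift r2 i) = ln `|sigma i x|.
Proof. by rewrite row_mxEl mxE. Qed.

Lemma log_complex x j : Lg x 0 (rshift r1 j) = 2 * ln (normc (tau j x)).
Proof. by rewrite row_mxEr mxE. Qed.

Lemma sigma_gt0 i x : x != 0 -> 0 < `|sigma i x|.
Proof. by move=> x0; rewrite normr_gt0 fmorph_eq0. Qed.

Lemma log_embeddingM x y : x != 0 -> y != 0 -> Lg (x * y) = Lg x + Lg y.
Proof.
move=> x0 y0; apply/rowP => k; rewrite [RHS]mxE; case: (split_ordP k) => j ->.
  by rewrite !log_real rmorphM normrM lnM ?posrE ?sigma_gt0.
rewrite !log_complex rmorphM ComplexField.Normc.normcM lnM ?posrE ?embedding_norm_gt0 //.
by rewrite mulrDr.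
Qed.

Lemma log_embeddingV x : x != 0 -> Lg x^-1 = - Lg x.
Proof.
move=> x0; apply/rowP => k; rewrite [RHS]mxE; case: (split_ordP k) => j ->.
  by rewrite !log_real fmorphV normfV lnV ?posrE ?sigma_gt0.
rewrite !log_complex fmorphV ComplexField.Normc.normcV lnV ?posrE ?embedding_norm_gt0 //.
by rewrite mulrN.
Qed.

Lemma log_embedding_sum x : x != 0 -> \sum_k Lg x 0 k = ln (nrm x).
Proof.
move=> x0; rewrite ln_prod => [|e]; last exact: embedding_norm_gt0.
rewrite big_split_ord !big_sumType; congr (_ + _).
  by apply: eq_bigr => i _; rewrite log_real normc_embedding_real.
apply: etrans (big_split _ _ _ _ _); apply: eq_bigr => j _.
by rewrite log_complex normc_embedding_conj mulrDl mul1r.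
Qed.

(** Apply [linear_forms_small_values] to the real embeddings and to the real and imaginary parts of
    the complex ones. *)
Lemma integer_in_log_box : exists2 c : R, 0 <= c &
  forall v : 'rV[R]_(r1 + r2), \sum_k v 0 k = 0 ->
    exists x, [/\ O x, x != 0 & forall k, Lg x 0 k <= v 0 k + c].
Proof.
pose l (e : embedding_index r1 r2) (k : 'I_d) : R := match e with
  | inl i => sigma i b`_k
  | inr (inl j) => complex.Re (tau j b`_k)
  | inr (inr j) => complex.Im (tau j b`_k) end.
have d0 : (0 < d)%N by exact: (adim_gt0 {:K}%AS).
have [c c0 cP] := linear_forms_small_values l d0 (card_embedding_index hemb).
(* Since the coordinates of v sum to 0, the sides y_e below have product Y^d, and Y = max(1, c)
   gives Y^d >= c. At a complex place |z| <= |Re z| + |Im z| doubles the bound, whence the constant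
   2 ln(2 Y). *)
pose Y := Num.max 1 c.
have Y1 : 1 <= Y by rewrite le_max lexx.
have Y0 : 0 < Y by exact: lt_le_trans Y1.
have lnY : 0 <= ln (2 * Y) by rewrite ln_ge0 // -[leLHS]mul1r ler_pM // ler1n.
exists (2 * ln (2 * Y)); first by rewrite mulr_ge0.
move=> v v0.
pose y (e : embedding_index r1 r2) : R := match e with
  | inl i => Y * expR (v 0 (lshift r2 i))
  | inr (inl j) | inr (inr j) => Y * expR (v 0 (rshift r1 j) / 2) end.
have y0 e : 0 < y e by case: e => [i|[j|j]]; rewrite mulr_gt0 ?expR_gt0.
have cy : c <= \prod_e y e.
  suff -> : \prod_e y e = Y ^+ d.
    apply: (@le_trans _ _ Y); first by rewrite le_max lexx orbT.
    by rewrite -[leLHS]expr1 ler_weXn2l.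
  rewrite -[LHS]lnK ?posrE ?prodr_gt0 // -[RHS]lnK ?posrE ?exprn_gt0 //.
  rewrite ln_prod // lnXn // -(card_embedding_index hemb) -sumr_const.
  congr expR; apply/eqP; rewrite -subr_eq0 -sumrB.
  under eq_bigr => e _.
    have -> : ln (y e) - ln Y = match e with
        inl i => v 0 (lshift r2 i)
      | inr (inl j) | inr (inr j) => v 0 (rshift r1 j) / 2 end.
      by case: e => [i|[j|j]]; rewrite lnM ?posrE ?expR_gt0 // expRK addrC addKr.
    over.
  rewrite !big_sumType /= -big_split /= -[X in _ == X]v0 big_split_ord /=.
  by under [X in _ + X == _]eq_bigr do rewrite -splitr.
have [w w0 wP] := cP y y0 cy.
exists (combination b w).
have x0 : combination b w != 0.
  by apply: contra_neq w0 => /(combination_eq0 hb).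
split => //; first exact: integers_combination.
move=> k; case: (split_ordP k) => j ->.
  rewrite log_real -ler_expR lnK ?posrE ?sigma_gt0 // addrC expRD.
  have := wP (inl j); rewrite /l /y.
  have -> : \sum_k (w 0 k)%:~R * sigma j b`_k = sigma j (combination b w).
    by rewrite rmorph_sum; apply: eq_bigr => i _; rewrite rmorphM rmorph_int.
  move=> /le_trans; apply; rewrite ler_wpM2r ?expR_ge0 //.
  rewrite -[leLHS]lnK ?posrE // ler_expR.
  apply: (@le_trans _ _ (ln (2 * Y))); last by lra.
  by rewrite ler_ln ?posrE ?mulr_gt0 //; lra.
rewrite log_complex -ler_pdivlMl // mulrC mulrDl [_ * _ / 2]mulrAC mulfV // mul1r.
rewrite -ler_expR lnK ?posrE ?embedding_norm_gt0 // addrC expRD lnK ?posrE ?mulr_gt0 //.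
apply: (le_trans (normc_le_Re_Im _)).
have -> : 2 * Y * expR (v 0 (rshift r1 j) / 2) =
   Y * expR (v 0 (rshift r1 j) / 2) + Y * expR (v 0 (rshift r1 j) / 2) by ring.
apply: lerD.
  have := wP (inr (inl j)); rewrite /l /y.
  suff -> : \sum_k (w 0 k)%:~R * complex.Re (tau j b`_k)
    = complex.Re (tau j (combination b w)) by [].
  rewrite rmorph_sum (big_morph (@complex.Re R) (id1 := 0) (op1 := +%R)) //;
    last by case=> ? ? [].
  apply: eq_bigr => i _; rewrite rmorphM rmorph_int.
  by rewrite -(rmorph_int (real_complex R)); case: (tau j _) => u u' /=; rewrite mul0r subr0.
have := wP (inr (inr j)); rewrite /l /y.
suff -> : \sum_k (w 0 k)%:~R * complex.Im (tau j b`_k)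
  = complex.Im (tau j (combination b w)) by [].
rewrite rmorph_sum (big_morph (@complex.Im R) (id1 := 0) (op1 := +%R)) //;
  last by case=> ? ? [].
apply: eq_bigr => i _; rewrite rmorphM rmorph_int.
by rewrite -(rmorph_int (real_complex R)); case: (tau j _) => u u' /=; rewrite mul0r addr0.
Qed.

(** The coordinates of [Lg x] sum to the logarithm of the norm, which is at least 0. Upper bounds on
    all coordinates therefore bound the norm from above and each coordinate from below. *)
Lemma integer_near_log_point : exists B : R, forall v : 'rV[R]_(r1 + r2), \sum_k v 0 k = 0 ->
    exists x, [/\ O x, x != 0, nrm x <= expR B & forall k, `|(Lg x - v) 0 k| <= B].
Proof.
have [c c0 cP] := integer_in_log_box.
exists ((r1 + r2)%:R * c + c) => v v0; have [x [Ox x0 xv]] := cP v v0.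
have nx : 0 <= ln (nrm x) by rewrite ln_ge0 // (place_norm_ge1 hemb hb).
have sumE : \sum_k (v 0 k + c - Lg x 0 k) + ln (nrm x) = (r1 + r2)%:R * c.
  rewrite -log_embedding_sum // -big_split /=.
  under eq_bigr do rewrite subrK.
  by rewrite big_split /= v0 add0r sumr_const card_ord mulr_natl.
have sum0 : 0 <= \sum_k (v 0 k + c - Lg x 0 k).
  by apply: sumr_ge0 => k _; rewrite subr_ge0.
exists x; split => // [|k].
  rewrite -[leLHS]lnK ?posrE ?place_norm_gt0 // ler_expR; lra.
rewrite [(_ - v) 0 k]mxE [(- v) 0 k]mxE ler_norml; apply/andP; split; last first.
  have := xv k; have : 0 <= (r1 + r2)%:R * c by rewrite mulr_ge0.
  by lra.
have : v 0 k + c - Lg x 0 k <= \sum_k (v 0 k + c - Lg x 0 k).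
  by rewrite [leRHS](bigD1 k) //= lerDl; apply: sumr_ge0 => i _; rewrite subr_ge0.
by lra.
Qed.

(** The norm of x is a positive integer m <= n that x divides, and m divides n!. Thus n! is a common
    multiple of all integers of norm at most n. *)
Lemma factorial_div_integer x (n : nat) : O x -> x != 0 -> nrm x <= n%:R ->
  O ((n`!)%:R / x).
Proof.
move=> Ox x0 xn; have [m [mE Om]] := place_norm_div hemb hb Ox x0.
have m0 : (0 < m)%N by rewrite -(ltr_nat R) -mE place_norm_gt0.
have /dvdnP[q ->] : (m %| n`!)%N by rewrite dvdn_fact // m0 -(ler_nat R) -mE.
by rewrite natrM -mulrA; apply: integersM => //; rewrite pmulrn; exact: integers_int.
Qed.

(* A functional that kills the logarithms of units takes finitely many values
   on integers of bounded norm, but such integers occur at bounded distance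
   from every point of the trace-zero hyperplane. *)
Lemma unit_functional (g : 'cV[R]_(r1 + r2)) (v : 'rV[R]_(r1 + r2)) :
  (forall u, @unit_group K u -> Lg u *m g = 0) -> \sum_k v 0 k = 0 ->
  v *m g = 0.
Proof.
move=> gunit v0; apply/eqP; apply: contraT => /matrix0Pn[i0 [j0]].
rewrite [i0]ord1 [j0]ord1 => {i0 j0}; set k := (v *m g) 0 0 => k0.
have [B BP] := integer_near_log_point.
pose G : R := \sum_i `|g i 0|.
have G0 : 0 <= G by apply: sumr_ge0.
pose D := Num.max B 0 * G.
(* Along the points n t v the functional moves in steps of 2 D + 1, while its value at the nearby
   integer is off by at most D: distinct indices give distinct values. *)
pose t : R := (2 * D + 1) / k.
have tE : t * k = 2 * D + 1 by rewrite /t mulfVK.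
have D0 : 0 <= D by rewrite mulr_ge0 // le_max lexx orbT.
have BP' n : exists x, [/\ O x, x != 0, nrm x <= expR B &
     `|(Lg x *m g) 0 0 - n%:R * (2 * D + 1)| <= D].
  have [|x [Ox x0 xB xv]] := BP ((n%:R * t) *: v).
    by under eq_bigr do rewrite mxE; rewrite -mulr_sumr v0 mulr0.
  exists x; split => //.
  have -> : (Lg x *m g) 0 0 - n%:R * (2 * D + 1) = ((Lg x - (n%:R * t) *: v) *m g) 0 0.
    rewrite mulmxBl -scalemxAl [in RHS]mxE [X in _ = _ + X]mxE [X in _ = _ - X]mxE.
    by rewrite -mulrA tE.
  rewrite mxE (le_trans (ler_norm_sum _ _ _)) // /D /G mulr_sumr.
  apply: ler_sum => i _; rewrite normrM ler_wpM2r //.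
  by rewrite (le_trans (xv i)) // le_max lexx.
have [x xP] := choice BP'.
(* Every x_i divides n!. Two of them that are congruent modulo n! have a unit as quotient, on which
   the functional must vanish. *)
pose n := (Num.truncn (expR B)).+1.
have xn i : nrm (x i) <= n%:R.
  by have [_ _ + _] := xP i; move=> /le_trans; apply; rewrite ltW // truncnS_gt.
have Ofact : O (n`!)%:R by rewrite pmulrn; exact: integers_int.
have fact0 : (n`!)%:R != 0 :> K.
  by rewrite pmulrn numfield_int_eq0 -lt0n fact_gt0.
have [|i [j [ij Oij]]] := integer_pigeonhole hb (f := x) Ofact fact0.
  by move=> i; have [] := xP i.
have [Oi i0 _ gi] := xP i; have [Oj j0 _ gj] := xP j.
have uji : unit_group (x j / x i).
  by apply: unit_group_of_congruent Oij fact0 => //; exact: factorial_div_integer.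
have := gunit _ uji.
rewrite log_embeddingM ?invr_eq0 // log_embeddingV // mulmxDl mulNmx.
move=> /(congr1 (fun A : 'M[R]_(1, 1) => A 0 0)).
rewrite [LHS]mxE [X in _ + X = _]mxE [RHS]mxE => e.
move: gi gj; rewrite !ler_norml => /andP[_ gi] /andP[gj _].
have : 1 <= j%:R - i%:R :> R.
  by rewrite -natrB ?(ltnW ij) // ler1n subn_gt0.
have p : 0 < 2 * D + 1 by lra.
rewrite -(ler_pM2r p); move: gi gj e.
set a := (Lg (x j) *m g) 0 0; set a' := (Lg (x i) *m g) 0 0.
rewrite mulrBl mul1r; set s := j%:R * _; set s' := i%:R * _.
by move=> *; exfalso; lra.
Qed.

Lemma log_unit_lattice0 : log_unit_lattice sigma tau 0.
Proof.
exists 1.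
  by split; rewrite ?oner_eq0 ?invr1 //; exact: integers1.
apply/rowP => k; rewrite [RHS]mxE; case: (split_ordP k) => j ->.
  by rewrite log_real rmorph1 normr1 ln1.
by rewrite log_complex rmorph1 ComplexField.Normc.normc1 ln1 mulr0.
Qed.

Lemma unit_groupV (u : K) : unit_group u -> unit_group u^-1.
Proof. by move=> [u0 Ou OV]; split; rewrite ?invr_eq0 ?invrK. Qed.

Lemma unit_groupM (u v : K) : unit_group u -> unit_group v -> unit_group (u * v).
Proof.
by move=> [u0 Ou OV] [v0 Ov OvV]; split; rewrite ?mulf_neq0 ?invfM //; exact: integersM.
Qed.

Lemma log_unit_latticeB u v : log_unit_lattice sigma tau u ->
  log_unit_lattice sigma tau v -> log_unit_lattice sigma tau (u - v).
Proof.
move=> [x Ux <-] [y Uy <-]; exists (x / y).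
  by apply: unit_groupM => //; exact: unit_groupV.
have [x0 _ _] := Ux; have [y0 _ _] := Uy.
by rewrite log_embeddingM ?invr_eq0 // log_embeddingV.
Qed.

(** Dirichlet's unit theorem: a functional separating v from the logarithms of units would
    contradict [unit_functional]. *)
Lemma trace_zero_in_span (v : 'rV[R]_(r1 + r2)) : \sum_k v 0 k = 0 ->
  linear_span (log_unit_lattice sigma tau) v.
Proof.
move=> v0; have [X XL Xspan] := finite_spanning_subset (log_unit_lattice sigma tau).
exists X => //; apply: contraT => /separating_functional[g gX].
rewrite (unit_functional _ v0) ?eqxx // => u Uu.
have uX : Lg u \in <<in_tuple X>>%VS by apply: Xspan; exists u.
rewrite (coord_span uX) mulmx_suml big1 // => i _.
by rewrite -scalemxAl gX ?scaler0 // mem_nth.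
Qed.

(** Dividing by the unit brings the logarithm of c within rho + eta of the point where all absolute
    values equal nrm(c)^(1/d). *)
Lemma balanced_associate (c : K) (eta : R) : c != 0 -> 0 < eta ->
  exists2 u : K, unit_group u & forall phi : {rmorphism K -> R[i]},
    nrm c <= (normc (phi (c / u)) *
       expR (covering_radius (log_unit_lattice sigma tau) + eta)) ^+ d.
Proof.
move=> c0 eta0.
set rho := covering_radius _.
(* At complex places the estimate concerns 2 ln |phi(c / u)|; after halving, the error is still at
   most rho + eta because rho is nonnegative. *)
have rho0 : 0 <= rho.
  by apply: covering_radius_ge0; exact: log_unit_lattice0.
have nc := place_norm_gt0 sigma tau c0.
pose m := ln (nrm c) / d%:R.
have d0 : (0 < d)%N by exact: (adim_gt0 {:K}%AS).
have dm : d%:R * m = ln (nrm c) by rewrite mulrC mulfVK // pnatr_eq0 -lt0n.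
pose v : 'rV[R]_(r1 + r2) := row_mx (\row_i (Lg c 0 (lshift r2 i) - m))
  (\row_j (Lg c 0 (rshift r1 j) - 2 * m)).
have v0 : \sum_k v 0 k = 0.
  rewrite big_split_ord /=.
  under eq_bigr do rewrite row_mxEl mxE.
  under [X in _ + X = _]eq_bigr do rewrite row_mxEr mxE.
  have := log_embedding_sum c0; rewrite big_split_ord /= -dm => sumL.
  rewrite !sumrB addrACA -opprD sumL.
  rewrite !sumr_const !card_ord -(card_embedding_index hemb) !card_sum !card_ord.
  by rewrite -(mulr_natl m) -(mulr_natl (2 * m)) !natrD; ring.
have [_ [u Uu <-] vu] := covering_radius_approx log_unit_lattice0 log_unit_latticeB
  eta0 (trace_zero_in_span v0).
exists u => // phi; have [u0 _ _] := Uu.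
have cu0 : c / u != 0 by rewrite mulf_neq0 ?invr_eq0.
have key : m <= ln (normc (phi (c / u))) + (rho + eta).
  have entry k : - (rho + eta) < v 0 k - Lg u 0 k.
    have := le_lt_trans (mx_entry_le_norm (v - Lg u) k) vu.
    by rewrite [(v - _) 0 k]mxE [(- Lg u) 0 k]mxE ltr_norml => /andP[].
  have [[i|[j|j]] phiE] := embedding_surj hemb phi; rewrite phiE.
  - have := entry (lshift r2 i); rewrite row_mxEl mxE !log_real normc_embedding_real.
    rewrite rmorphM fmorphV normrM normfV lnM ?posrE ?invr_gt0 ?sigma_gt0 //.
    rewrite lnV ?posrE ?sigma_gt0 //.
    by lra.
  - have := entry (rshift r1 j); rewrite row_mxEr mxE !log_complex.
    rewrite rmorphM fmorphV ComplexField.Normc.normcM ComplexField.Normc.normcV.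
    rewrite lnM ?posrE ?invr_gt0 ?embedding_norm_gt0 // lnV ?posrE ?embedding_norm_gt0 //.
    by lra.
  - have := entry (rshift r1 j); rewrite row_mxEr mxE !log_complex normc_embedding_conj.
    rewrite rmorphM fmorphV ComplexField.Normc.normcM ComplexField.Normc.normcV.
    rewrite lnM ?posrE ?invr_gt0 ?embedding_norm_gt0 // lnV ?posrE ?embedding_norm_gt0 //.
    by lra.
rewrite -[leLHS]lnK ?posrE // -dm mulrC mulr_natr -mulr_natl.
rewrite expRM_natl ler_pXn2r ?nnegrE ?expR_ge0 //; last first.
  by rewrite mulr_ge0 ?expR_ge0 ?normc_ge0.
rewrite -[X in X * _]lnK ?posrE ?embedding_norm_gt0 // -expRD ler_expR //.
Qed.

End UnitTheorem.

(** * Orders at a prime ideal *)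

Lemma idealM_sub (F : fieldType) (I J S : set F) : S 0 ->
  (forall x y, S x -> S y -> S (x + y)) ->
  (forall x y, I x -> J y -> S (x * y)) -> idealM I J `<=` S.
Proof.
move=> S0 SD SM _ [n [x [y [Ix Jy ->]]]].
by elim/big_ind: _ => // i _; exact: SM.
Qed.

Lemma idealM_mul (F : fieldType) (I J : set F) x y : I x -> J y -> idealM I J (x * y).
Proof.
by move=> Ix Jy; exists 1%N, (fun=> x), (fun=> y); split => //; rewrite big_ord1.
Qed.

Lemma idealM0 (F : fieldType) (I J : set F) : idealM I J 0.
Proof.
by exists 0%N, (fun=> 0), (fun=> 0); split; rewrite ?big_ord0 // => -[].
Qed.

Lemma idealM_add (F : fieldType) (I J : set F) x y :
  idealM I J x -> idealM I J y -> idealM I J (x + y).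
Proof.
move=> [n [a [c [Ia Jc ->]]]] [m [a' [c' [Ia' Jc' ->]]]].
exists (n + m)%N, (fun i => match fintype.split i with inl k => a k | inr k => a' k end),
  (fun i => match fintype.split i with inl k => c k | inr k => c' k end).
split; [by move=> i; case: (fintype.split i)|by move=> i; case: (fintype.split i)|].
rewrite big_split_ord /=; congr (_ + _); apply: eq_bigr => i _.
  by rewrite (unsplitK (inl i)).
by rewrite (unsplitK (inr i)).
Qed.

Section PrimeIdeal.
Variables (K : fieldExtType rat) (b : (\dim {:K}).-tuple K).
Hypothesis hb : integral_basis b.
Local Notation O := (@ring_of_integers K).
Variable P : set K.
Hypothesis hP : prime_ideal P.

Lemma prime_sub x : P x -> O x.
Proof. by case: hP => -[PO _ _ _] _ _ _; exact: PO. Qed.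

Lemma prime0 : P 0.
Proof. by case: hP => -[]. Qed.

Lemma primeD x y : P x -> P y -> P (x + y).
Proof. by case: hP => -[_ _ PD _] _ _ _; exact: PD. Qed.

Lemma primeM a x : O a -> P x -> P (a * x).
Proof. by case: hP => -[_ _ _ PM] _ _ _; exact: PM. Qed.

Lemma primeN x : P x -> P (- x).
Proof. by rewrite -mulN1r; apply: primeM; exact/integersN/integers1. Qed.

Lemma primeB x y : P x -> P y -> P (x - y).
Proof. by move=> Px /primeN; exact: primeD. Qed.

Lemma prime_mulN x y : O x -> O y -> ~ P x -> ~ P y -> ~ P (x * y).
Proof. by case: hP => _ _ _ PM Ox Oy Px Py /PM[]. Qed.

Lemma prime1 : ~ P 1.
Proof. by case: hP. Qed.

Lemma prime_expN x n : O x -> ~ P x -> ~ P (x ^+ n).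
Proof.
move=> Ox Px; elim: n => [|n IHn]; first by rewrite expr0; exact: prime1.
by rewrite exprS; apply: prime_mulN => //; exact: integersX.
Qed.

(** Powers of s repeat modulo a nonzero a in P, so s^i (s^(k+1) - 1) lies in P for some i and k.
    Primality leaves s^(k+1) = 1 modulo P, and s^k inverts s. *)
Lemma prime_maximal s : O s -> ~ P s -> exists r q, [/\ O r, P q & 1 = r * s + q].
Proof.
move=> Os Ps; have [_ [a Pa a0] _ PM] := hP.
have [i [j [ij Oij]]] := integer_pigeonhole hb (prime_sub Pa) a0 (fun n => integersX n Os).
have [k kE] : exists k, j = (i + k.+1)%N by exists (j - i).-1; lia.
have {Oij} : P (s ^+ i * (s ^+ k.+1 - 1)).
  have -> : s ^+ i * (s ^+ k.+1 - 1) = (s ^+ j - s ^+ i) / a * a.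
    by rewrite mulfVK // kE exprD mulrBr mulr1.
  exact: primeM.
move=> /PM[||/(prime_expN Os Ps)//|Ps1].
- exact: integersX.
- by apply: integersB; [exact: integersX|exact: integers1].
exists (s ^+ k), (- (s ^+ k.+1 - 1)); split; [exact: integersX|exact: primeN|].
by rewrite exprSr; ring.
Qed.

Lemma idealX_sub n : idealX P n `<=` O.
Proof.
elim: n => [//|n IHn] /=; apply: idealM_sub; first exact: integers0.
  by move=> x y; exact: integersD.
by move=> x y /prime_sub Ox /IHn; exact: integersM.
Qed.

Lemma idealX0 n : idealX P n 0.
Proof. by case: n => [|n]; [exact: integers0|exact: idealM0]. Qed.

Lemma idealXD n x y : idealX P n x -> idealX P n y -> idealX P n (x + y).
Proof. by case: n => [|n]; [exact: integersD|exact: idealM_add]. Qed.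

Lemma idealXM n a x : O a -> idealX P n x -> idealX P n (a * x).
Proof.
move=> Oa; case: n => [|n]; first exact: integersM.
move: x; apply: idealM_sub => [|x y Px Py|x y Px Py].
- by rewrite mulr0; exact: idealM0.
- by rewrite mulrDr; exact: idealM_add.
- by rewrite mulrA; apply: idealM_mul => //; exact: primeM.
Qed.

Lemma idealXS n : idealX P n.+1 `<=` idealX P n.
Proof.
apply: idealM_sub => [|x y|x y /prime_sub Ox]; [exact: idealX0|exact: idealXD|].
exact: idealXM.
Qed.

Lemma idealX1 x : idealX P 1 x -> P x.
Proof.
move: x; apply: idealM_sub => [|x y|x y Px Oy]; [exact: prime0|exact: primeD|].
by rewrite mulrC; exact: primeM.
Qed.

Lemma idealX_expr x n : P x -> idealX P n (x ^+ n).
Proof.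
move=> Px; elim: n => [|n IHn]; first by rewrite expr0; exact: integers1.
by rewrite exprS; exact: idealM_mul.
Qed.

(** Induction: in 1 = r_n s + q_n with q_n in P^n, replace q_n by q_n (r s + q), where q is in P. *)
Lemma idealX_comaximal n s : O s -> ~ P s ->
  exists r q, [/\ O r, idealX P n q & 1 = r * s + q].
Proof.
move=> Os Ps; have [r [q [Or Pq rsq]]] := prime_maximal Os Ps.
elim: n => [|n [rn [qn [Orn Pqn E]]]].
  by exists 0, 1; split; [exact: integers0|exact: integers1|rewrite mul0r add0r].
exists (rn + qn * r), (q * qn); split.
- by apply: integersD => //; apply: integersM => //; exact: (@idealX_sub n).
- exact: idealM_mul.
have -> : (rn + qn * r) * s + q * qn = rn * s + qn * (r * s + q) by ring.
by rewrite -rsq mulr1.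
Qed.

(* Starting from (aO : 1), multiply b by some s * q ^ m to bring one more generator q of
   P into (aO : b) while keeping (aO : b) inside P. *)
Lemma colon_ideal_prime a (l : seq K) : P a -> a != 0 -> (forall q, q \in l -> P q) ->
  exists c, [/\ O c, forall q, q \in l -> O (q * c / a) &
    forall r, O r -> O (r * c / a) -> P r].
Proof.
move=> Pa a0; elim: l => [_|q l IHl lP].
  exists 1; split => //; first exact: integers1.
  by move=> r Or; rewrite mulr1 => /primeM/(_ Pa); rewrite mulfVK.
have [x xl|c [Oc lc cP]] := IHl; first by apply: lP; rewrite inE xl orbT.
have Pq : P q by apply: lP; rewrite mem_head.
have Oq := prime_sub Pq.
(* A pigeonhole modulo a puts q^i (q^(k+1) - 1) c in a O, and q^(k+1) - 1 is outside P since q is in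
   P. The least such exponent is some m + 1: exponent 0 would put s in P by [cP]. Its minimality
   keeps the new colon ideal inside P. *)
pose kills n := `[< exists s, [/\ O s, ~ P s & O (s * (c * q ^+ n) / a)] >].
have exn : exists n, kills n.
  have [||n|i [j [ij Oij]]] := integer_pigeonhole hb (x := a) (f := fun n => c * q ^+ n).
  - exact: prime_sub.
  - exact: a0.
  - by apply: integersM => //; exact: integersX.
  have [k kE] : exists k, j = (i + k.+1)%N by exists (j - i).-1; lia.
  exists i; apply/asboolP; exists (q ^+ k.+1 - 1); split.
  - by apply: integersB; [exact: integersX|exact: integers1].
  - move=> Pq1; apply: prime1.
    rewrite -[1](subKr (q ^+ k.+1)); apply: primeB => //.
    by rewrite exprSr; apply: primeM => //; exact: integersX.
  - by congr (O (_ / _)): Oij; rewrite kE exprD; ring.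
case: (ex_minnP exn) => -[|m] /asboolP[s [Os Ps Osm]] minm.
  by case: Ps; apply: cP => //; move: Osm; rewrite expr0 mulr1.
exists (s * c * q ^+ m); split.
- by apply: integersM; [exact: integersM|exact: integersX].
- move=> x; rewrite inE => /predU1P[->|xl].
    by congr (O (_ / _)): Osm; rewrite exprS; ring.
  have -> : x * (s * c * q ^+ m) / a = (x * c / a) * (s * q ^+ m) by ring.
  by apply: integersM; [exact: lc|apply: integersM => //; exact: integersX].
- move=> r Or Orm; have [_ _ _ PM] := hP.
  have : P (r * s).
    apply: contrapT => Prs; suff : (m.+1 <= m)%N by rewrite ltnn.
    apply: minm; apply/asboolP; exists (r * s); split => //; first exact: integersM.
    by congr (O (_ / _)): Orm; ring.
  by move=> /PM[].
Qed.

(** [gamma] acts as an inverse of P, locally at P. The colon ideal lemma, applied to representatives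
    of P modulo a, gives gamma = c / a with gamma P in O. If gamma P were in P, all a gamma^n would
    be in O, so gamma would be an integer and 1 would lie in P. *)
Lemma prime_inverse : exists gamma pi : K,
  [/\ forall x, P x -> O (gamma * x), P pi & ~ P (gamma * pi)].
Proof.
have [_ [a Pa a0] _ _] := hP.
have [A aA] := mult_matrix_exists hb (prime_sub Pa).
have [T [code [_ codeP]]] := residue_code hb a0 aA.
pose rep t := xget 0 [set q | P q /\ code q = t].
have repP t : P (rep t).
  by rewrite /rep; case: xgetP => [x _ []//|_]; exact: prime0.
have codeK q : P q -> code (rep (code q)) = code q.
  by move=> Pq; rewrite /rep; case: xgetP => [x _ []//|/(_ q)[]].
have [|c [Oc lc cP]] := colon_ideal_prime (l := [seq rep t | t <- enum T]) Pa a0.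
  by move=> _ /mapP[t _ ->].
have gammaP x : P x -> O (c / a * x).
  move=> Px; have -> : c / a * x = (x - rep (code x)) / a * c + rep (code x) * c / a.
    by ring.
  apply: integersD.
    apply: integersM => //; apply: codeP; rewrite ?codeK //; exact: prime_sub.
  by apply: lc; apply: map_f; rewrite mem_enum.
exists (c / a).
have [[p [Pp Pgp]]|noP] := pselect (exists p, P p /\ ~ P (c / a * p)).
  by exists p.
have stab x : P x -> P (c / a * x) by move=> Px; apply: contrapT => ?; apply: noP; exists x.
case: prime1; apply: cP; first exact: integers1.
rewrite mul1r; apply: (integers_bounded_powers hb (prime_sub Pa) a0) => n.
rewrite mulrC; apply: prime_sub; elim: n => [|n IHn]; first by rewrite expr0 mul1r.
by rewrite exprS -(mulrA (c / a)); exact: stab.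
Qed.

Variables gamma pi : K.
Hypothesis gammaP : forall x, P x -> O (gamma * x).
Hypothesis Ppi : P pi.
Hypothesis Pu : ~ P (gamma * pi).

Let Ou : O (gamma * pi). Proof. exact: gammaP. Qed.

(* [x] has order at least [n] at [P]; [gamma] has order -1 at [P] and order
   at least 0 at the other primes. *)
Definition order_ge n x := exists s, [/\ O s, ~ P s & O (s * gamma ^+ n * x)].

Lemma gammaX n x : idealX P n x -> O (gamma ^+ n * x).
Proof.
elim: n x => [x|n IHn]; first by rewrite expr0 mul1r.
apply: idealM_sub => [|x y|x y Px /IHn Oy]; first by rewrite mulr0; exact: integers0.
  by rewrite mulrDr; exact: integersD.
have -> : gamma ^+ n.+1 * (x * y) = (gamma * x) * (gamma ^+ n * y) by rewrite exprS; ring.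
by apply: integersM => //; exact: gammaP.
Qed.

Lemma order_geD n x y : order_ge n x -> order_ge n y -> order_ge n (x + y).
Proof.
move=> [s [Os Ps Osx]] [t [Ot Pt Oty]]; exists (s * t); split.
- exact: integersM.
- exact: prime_mulN.
have -> : s * t * gamma ^+ n * (x + y)
   = t * (s * gamma ^+ n * x) + s * (t * gamma ^+ n * y) by ring.
by apply: integersD; exact: integersM.
Qed.

Lemma order_geM m n x y : order_ge m x -> order_ge n y -> order_ge (m + n) (x * y).
Proof.
move=> [s [Os Ps Osx]] [t [Ot Pt Oty]]; exists (s * t); split.
- exact: integersM.
- exact: prime_mulN.
have -> : s * t * gamma ^+ (m + n) * (x * y)
   = (s * gamma ^+ m * x) * (t * gamma ^+ n * y) by rewrite exprD; ring.
exact: integersM.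
Qed.

Lemma order_ge_integer x : O x -> order_ge 0 x.
Proof.
move=> Ox; exists 1; split; [exact: integers1|exact: prime1|].
by rewrite expr0 !mul1r.
Qed.

Lemma order_geZ n a x : O a -> order_ge n x -> order_ge n (a * x).
Proof. by move=> /order_ge_integer; exact: order_geM. Qed.

Lemma order_geS n x : order_ge n.+1 x -> order_ge n x.
Proof.
move=> [s [Os Ps Osx]]; exists (s * (gamma * pi)).
split; [exact: integersM|exact: prime_mulN|].
have -> : s * (gamma * pi) * gamma ^+ n * x = pi * (s * gamma ^+ n.+1 * x).
  by rewrite exprS; ring.
by apply: integersM => //; exact: prime_sub.
Qed.

Lemma order_ge_sub m n x : (m <= n)%N -> order_ge n x -> order_ge m x.
Proof.
move=> /subnK <-; elim: (n - m)%N => [//|k IHk]; rewrite addSn => /order_geS.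
exact: IHk.
Qed.

Lemma order_ge_idealX n x : idealX P n x -> order_ge n x.
Proof.
move=> /gammaX Ox; exists 1; split; [exact: integers1|exact: prime1|].
by rewrite mul1r.
Qed.

Lemma order_ge_pi n x : order_ge n.+1 (pi * x) -> order_ge n x.
Proof.
move=> [s [Os Ps Osx]]; exists (s * (gamma * pi)).
split; [exact: integersM|exact: prime_mulN|].
by congr (O _): Osx; rewrite exprS; ring.
Qed.

(** The element v = s (gamma pi)^n is outside P, hence invertible modulo P^n: 1 = r v + q. Both r v
    x and q x are in P^n, since v x is pi^n times an integer. *)
Lemma idealX_order_ge n x : O x -> order_ge n x -> idealX P n x.
Proof.
move=> Ox [s [Os Ps Osx]].
have Pv : ~ P (s * (gamma * pi) ^+ n).
  by apply: prime_mulN => //; [exact: integersX|exact: prime_expN].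
have Ov : O (s * (gamma * pi) ^+ n) by apply: integersM => //; exact: integersX.
have [r [q [Or Pq E]]] := idealX_comaximal n Ov Pv.
rewrite -[x]mul1r E mulrDl; apply: idealXD; last first.
  by rewrite mulrC; exact: idealXM.
rewrite -mulrA; apply: idealXM => //.
have -> : s * (gamma * pi) ^+ n * x = (s * gamma ^+ n * x) * pi ^+ n.
  by rewrite exprMn; ring.
by apply: idealXM => //; exact: idealX_expr.
Qed.

Lemma prime_order_ge x : O x -> order_ge 1 x -> P x.
Proof. by move=> Ox /(idealX_order_ge Ox)/idealX1. Qed.

(** If x were in every P^n, all gamma^n x would be integers, so gamma would be one and gamma pi
    would lie in P. *)
Lemma not_all_idealX x : O x -> x != 0 -> exists n, ~ idealX P n x.
Proof.
move=> Ox x0; apply/not_existsP => allP; apply: Pu; apply: primeM => //.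
apply: (integers_bounded_powers hb Ox x0) => n.
by rewrite mulrC; apply: gammaX; exact: contrapT (allP n).
Qed.

Lemma has_order_exists x : O x -> x != 0 -> exists k, has_order P x k.
Proof.
move=> Ox x0; have [n nP] := not_all_idealX Ox x0.
have exn : exists n, `[< ~ idealX P n x >] by exists n; exact/asboolP.
case: (ex_minnP exn) => -[|k] /asboolP kP kmin; first by case: kP.
exists k; split => //; apply: contrapT => /asboolP/kmin; by rewrite ltnn.
Qed.

(** A form of membership in O_{P} that speaks of P alone: some power of P clears the denominators of
    x. [integral_outside_integers_outside] relates it to the other primes. *)
Definition integral_outside x := exists m, forall y, idealX P m y -> O (y * x).

Lemma integral_outside_integer x : O x -> integral_outside x.
Proof. by move=> Ox; exists 0%N => y Oy; exact: integersM. Qed.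

Lemma idealX_le m n : (m <= n)%N -> idealX P n `<=` idealX P m.
Proof.
move=> /subnK <-; elim: (n - m)%N => [//|k IHk]; rewrite addSn => x /idealXS; exact: IHk.
Qed.

Lemma integral_outsideD x y :
  integral_outside x -> integral_outside y -> integral_outside (x + y).
Proof.
move=> [m mx] [n ny]; exists (maxn m n) => z Pz; rewrite mulrDr.
by apply: integersD; [apply: mx; apply: idealX_le Pz; rewrite leq_maxl |
                      apply: ny; apply: idealX_le Pz; rewrite leq_maxr].
Qed.

Lemma integral_outsideZ a x : O a -> integral_outside x -> integral_outside (a * x).
Proof.
by move=> Oa [m mx]; exists m => y /mx Oyx; rewrite mulrCA; exact: integersM.
Qed.

Lemma integral_outsideB x y :
  integral_outside x -> integral_outside y -> integral_outside (x - y).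
Proof.
move=> mx my; apply: integral_outsideD => //; rewrite -mulN1r.
by apply: integral_outsideZ => //; exact/integersN/integers1.
Qed.

Lemma integral_outside_comaximal n x s : integral_outside x -> O s -> ~ P s ->
  exists r q, [/\ O r, 1 = r * s + q & O (gamma ^+ n * q * x)].
Proof.
move=> [m mx] Os Ps.
have [r [q [Or Pq E]]] := idealX_comaximal m Os Ps.
have [r' [q' [Or' Pq' E']]] := idealX_comaximal n Os Ps.
exists (r + q * r'), (q * q'); split.
- by apply: integersD => //; apply: integersM => //; exact: idealX_sub Pq.
- have -> : (r + q * r') * s + q * q' = r * s + q * (r' * s + q') by ring.
  by rewrite -E' mulr1.
have -> : gamma ^+ n * (q * q') * x = (gamma ^+ n * q') * (q * x) by ring.
by apply: integersM; [exact: gammaX|exact: mx].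
Qed.

(** Integrality at P and away from P combine: in 1 = r s + q, the factor s clears denominators at P,
    and q, deep enough in P, clears the others. *)
Lemma integral_outside_order_ge n x : integral_outside x -> order_ge n x ->
  O (gamma ^+ n * x).
Proof.
move=> Sx [s [Os Ps Osx]].
have [r [q [Or E Oq]]] := integral_outside_comaximal n Sx Os Ps.
rewrite -[_ * x]mul1r E mulrDl; apply: integersD.
  have -> : r * s * (gamma ^+ n * x) = r * (s * gamma ^+ n * x) by ring.
  exact: integersM.
by congr (O _): Oq; ring.
Qed.

(** Induction on the exponent n of y: for z in P and t in P^(m+n), rewrite z t x y as t (x (z y)),
    where z y has a smaller exponent. *)
Lemma integral_outsideM x y :
  integral_outside x -> integral_outside y -> integral_outside (x * y).
Proof.
move=> [m mx] [n ny]; exists (m + n)%N.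
elim: n y ny => [y ny z|n IHn y ny].
  rewrite addn0 => /mx Ozx; rewrite mulrA; apply: integersM => //.
  by rewrite -[y]mul1r; apply: ny; exact: integers1.
rewrite addnS; apply: idealM_sub => [|z t|z t Pz Pt].
- by rewrite mul0r; exact: integers0.
- by rewrite mulrDl; exact: integersD.
have -> : z * t * (x * y) = t * (x * (z * y)) by ring.
by apply: IHn => // w Pw; rewrite mulrA [w * z]mulrC; apply: ny; exact: idealM_mul.
Qed.

(** A rational integer denominator m of x has some order k at P, so gamma^k m is an integer outside
    P; take x = gamma^k (m x) / (gamma^k m). *)
Lemma local_fraction x : exists m s o,
  [/\ O s, ~ P s, O o & x = gamma ^+ m * o / s].
Proof.
have [m m0 Om] := integers_denominator hb x.
have m0' : m%:~R != 0 :> K by rewrite numfield_int_eq0.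
have Omz := integers_int K m.
have [k [Pk Pk1]] := has_order_exists Omz m0'.
exists k, (gamma ^+ k * m%:~R), (m%:~R * x); split => //.
- exact: gammaX.
- move=> /gammaP Ogm; apply: Pk1; apply: idealX_order_ge => //.
  by exists 1; split; [exact: integers1|exact: prime1|rewrite mul1r exprS -mulrA].
have g0 : gamma != 0.
  by apply: contra_notN Pu => /eqP ->; rewrite mul0r; exact: prime0.
by field; rewrite m0' expf_neq0.
Qed.

(** In x = gamma^m w / s, division by s is replaced by multiplication by an inverse r of s modulo
    P^(m+1); the error has the factor gamma^m (1 - r s), of order at least 1. *)
Lemma local_approximation x : exists2 a, integral_outside a & order_ge 1 (x - a).
Proof.
have [m [s [w [Os Ps Ow ->]]]] := local_fraction x.
have [r [q [Or Pq E]]] := idealX_comaximal m.+1 Os Ps.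
exists (gamma ^+ m * (r * w)).
  exists m => y /gammaX Oy; rewrite mulrA [y * _]mulrC.
  by apply: integersM => //; exact: integersM.
exists s; split => //.
have s0 : s != 0 by apply: contra_notN Ps => /eqP ->; exact: prime0.
have -> : s * gamma ^+ 1 * (gamma ^+ m * w / s - gamma ^+ m * (r * w))
   = gamma ^+ m.+1 * (1 - r * s) * w by rewrite (exprS gamma m); field.
by rewrite {1}E [_ - _]addrAC subrr add0r; apply: integersM => //; exact: gammaX.
Qed.

Section Digits.
Variables (N : nat) (rep : 'I_N -> K).
Hypothesis Orep : forall i, O (rep i).
Hypothesis rep_inj : forall i j, P (rep i - rep j) -> i = j.

Definition digit_sum (l : seq 'I_N) := foldr (fun i z => rep i + pi * z) 0 l.

Lemma digit_sum_integer l : O (digit_sum l).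
Proof.
elim: l => [|i l IHl] /=; first exact: integers0.
by apply: integersD => //; apply: integersM => //; exact: prime_sub.
Qed.

Lemma digit_sum_inj l l' : size l = size l' ->
  order_ge (size l) (digit_sum l - digit_sum l') -> l = l'.
Proof.
elim: l l' => [|i l IHl] [|i' l'] //= [sz] ord.
have Pz m : P (pi * digit_sum m).
  by rewrite mulrC; apply: primeM => //; exact: digit_sum_integer.
have ii' : i = i'.
  apply: rep_inj.
  have -> : rep i - rep i' = (rep i + pi * digit_sum l - (rep i' + pi * digit_sum l'))
     - (pi * digit_sum l - pi * digit_sum l') by ring.
  apply: primeB; last exact: primeB.
  apply: prime_order_ge; last exact: order_ge_sub ord.
  by apply: integersB; apply: integersD => //; apply: prime_sub.
congr (_ :: _) => //; apply: IHl => //; apply: order_ge_pi.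
by congr (order_ge _ _): ord; rewrite ii'; ring.
Qed.

(** The N^n sums of n digits in base pi never differ by an element of order at least n, so they are
    incongruent modulo x and have distinct codes. *)
Lemma digit_sum_code n x (T : finType) (code : K -> T) : x != 0 -> order_ge n x ->
  (forall u v, O u -> O v -> code u = code v -> O ((u - v) / x)) ->
  (N ^ n <= #|T|)%N.
Proof.
move=> x0 nx codeP; rewrite -[N in (N ^ n)%N]card_ord -card_tuple.
apply: (@leq_card _ _ (fun t : n.-tuple 'I_N => code (digit_sum t))) => t t' /codeP Ot.
apply/val_inj/digit_sum_inj; first by rewrite !size_tuple.
rewrite size_tuple -(divfK x0 (_ - _)); apply: order_geZ => //.
by apply: Ot; exact: digit_sum_integer.
Qed.

End Digits.

End PrimeIdeal.

(** * Residue classes modulo a prime ideal *)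

Section IdealNorm.
Variables (K : fieldExtType rat) (b : (\dim {:K}).-tuple K).
Hypothesis hb : integral_basis b.
Local Notation O := (@ring_of_integers K).
Variable P : set K.
Hypothesis hP : prime_ideal P.

(** P contains a nonzero a and O / a O is finite, so [fset_set] enumerates the classes modulo P, and
    a class is coded by its position. *)
Lemma ideal_norm_residues :
  exists (code : K -> 'I_(ideal_norm P)) (rep : 'I_(ideal_norm P) -> K),
  [/\ forall i, O (rep i), forall i j, P (rep i - rep j) -> i = j &
      forall u v, O u -> O v -> code u = code v -> P (u - v)].
Proof.
pose cls x : set K := [set y | O y /\ P (y - x)].
have cls_id x : O x -> cls x x by move=> Ox; split; rewrite ?subrr //; exact: (prime0 hP).
have cls_eq x y : O x -> O y -> P (x - y) -> cls x = cls y.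
  move=> Ox Oy xy; apply/seteqP; split=> z [Oz Pz]; split => //.
    by rewrite -(subrK x z) -addrA; exact: (primeD hP).
  by rewrite -(subrK y z) -addrA; apply: (primeD hP) => //; rewrite -opprB; exact: (primeN hP).
pose X := [set cls x | x in O].
have finX : finite_set X.
  have [_ [a Pa a0] _ _] := hP.
  have Oa := prime_sub hP Pa.
  have [A aA] := mult_matrix_exists hb Oa.
  have [T [code [_ codeP]]] := residue_code hb a0 aA.
  pose rep t := xget 0 [set x | O x /\ code x = t].
  apply: (@sub_finite_set _ _ [set cls (rep t) | t in [set: T]]); last first.
    by apply: finite_image; exact: finite_finset.
  move=> _ [x Ox <-]; exists (code x) => //.
  have [Or cr] : O (rep (code x)) /\ code (rep (code x)) = code x.
    by rewrite /rep; case: xgetP => [x' _ //|/(_ x)[]].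
  by apply: cls_eq => //; rewrite -(divfK a0 (_ - _)); apply: (primeM hP) => //; exact: codeP.
have NE : ideal_norm P = size (fset_set X) by [].
have memX x : O x -> cls x \in (fset_set X : seq _).
  by move=> Ox; rewrite in_fset_set //; apply/mem_set; exists x.
have N0 : (0 < ideal_norm P)%N.
  by rewrite NE; case: (fset_set X : seq _) (memX 0 (integers0 K)).
(* The default 0 occurs only for u outside O. *)
have idx_lt u : ((if cls u \in (fset_set X : seq _) then
    index (cls u) (fset_set X : seq _) else 0) < ideal_norm P)%N.
  by case: ifP => // uX; rewrite NE index_mem.
have repP (i : 'I_(ideal_norm P)) : exists x, O x /\ cls x = nth set0 (fset_set X : seq _) i.
  have : nth set0 (fset_set X : seq _) i \in (fset_set X : seq _) by rewrite mem_nth // -NE.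
  by rewrite in_fset_set // => /set_mem[x Ox xE]; exists x.
have [rep repE] := choice repP.
exists (fun u => Ordinal (idx_lt u)), rep; split=> [i|i j Pij|u v Ou Ov /(congr1 val) /=].
- by have [] := repE i.
- have [Oi ci] := repE i; have [Oj cj] := repE j.
  have := cls_eq _ _ Oi Oj Pij; rewrite ci cj => /eqP.
  by rewrite nth_uniq ?fset_uniq -?NE // => /eqP/val_inj.
rewrite !memX // => /(congr1 (nth set0 (fset_set X : seq _))).
by rewrite !nth_index ?memX // => uv; have [] : cls v u by rewrite -uv; exact: cls_id.
Qed.

End IdealNorm.

(** * Norm estimates *)

Section NormBounds.
Variables (R : realType) (K : fieldExtType rat) (r1 r2 : nat).
Variables (sigma : 'I_r1 -> {rmorphism K -> R}) (tau : 'I_r2 -> {rmorphism K -> R[i]}).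
Hypothesis hemb : embeddings_listed sigma tau.
Variable b : (\dim {:K}).-tuple K.
Hypothesis hb : integral_basis b.
Variable P : set K.
Hypothesis hP : prime_ideal P.
Local Notation O := (@ring_of_integers K).
Local Notation nrm := (place_norm sigma tau).
Local Notation d := (\dim {:K}).

Lemma ideal_norm_pow_le gamma pi n x :
  (forall y, P y -> O (gamma * y)) -> P pi -> ~ P (gamma * pi) ->
  O x -> x != 0 -> order_ge P gamma n x -> (ideal_norm P)%:R ^+ n <= nrm x.
Proof.
move=> gammaP Ppi Pu Ox x0 nx.
have [T [code [<- codeP]]] := place_norm_code hemb hb Ox x0.
have [_ [rep [Orep rep_inj _]]] := ideal_norm_residues hb hP.
rewrite -natrX ler_nat.
exact: (digit_sum_code hb hP gammaP Ppi Pu Orep rep_inj x0 nx codeP).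
Qed.

(* Count residues along m O <= y P <= y O <= O, where y = m c. *)
Lemma norm_multiplier_ge1 c : c != 0 -> (forall x, P x -> O (c * x)) ->
  1 <= nrm c * (ideal_norm P)%:R.
Proof.
move=> c0 cP; have [m m0 Oy] := integers_denominator hb c.
have mK0 : m%:~R != 0 :> K by rewrite numfield_int_eq0.
have y0 : m%:~R * c != 0 by rewrite mulf_neq0.
have [T [code [cardT codeT]]] := place_norm_code hemb hb Oy y0.
have [codeP [_ [_ _ codePP]]] := ideal_norm_residues hb hP.
pose rep t := xget 0 [set x | O x /\ code x = t].
have repE x : O x -> O (rep (code x)) /\ code (rep (code x)) = code x.
  by move=> Ox; rewrite /rep; case: xgetP => [x' _ //|/(_ x)[]].
(* The |m|^d combinations with coordinates in [0, |m|) are pairwise incongruent modulo m. Each is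
   determined by its class modulo y = m c and the class modulo P of its quotient by y, so |m|^d is
   at most nrm(y) N(P). *)
pose row_of (v : {ffun 'I_d -> 'I_(`|m|%N)}) := \row_i (v i)%:Z.
pose w v := combination b (row_of v).
have Ow v : O (w v) by exact: integers_combination.
pose quo v := (w v - rep (code (w v))) / (m%:~R * c).
have Oquo v : O (quo v).
  by have [Or cr] := repE _ (Ow v); apply: codeT; rewrite ?cr.
have : (`|m| ^ d <= #|T| * ideal_norm P)%N.
  rewrite -[ideal_norm P]card_ord -card_prod -{1}[ `|m|%N]card_ord -[d]card_ord -card_ffun.
  apply: (@leq_card _ _ (fun v => (code (w v), codeP (quo v)))) => v v' [ew eq].
  have Pq := codePP _ _ (Oquo v) (Oquo v') eq.
  have E : (w v - w v') / m%:~R = c * (quo v - quo v').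
    by rewrite /quo ew; field; rewrite mK0 c0.
  have /(combination_exists hb)[k kE] : O ((w v - w v') / m%:~R) by rewrite E; exact: cP.
  have : combination b (row_of v - row_of v' - m *: k) = 0.
    rewrite !combinationB combinationZ -kE -/(w v) -/(w v'); field; exact: mK0.
  move=> /(combination_eq0 hb)/rowP E0; apply/ffunP => i; apply/val_inj.
  have := E0 i; rewrite !mxE => /eqP; rewrite subr_eq0 => /eqP vv'.
  have := ltn_ord (v i); have := ltn_ord (v' i) => lt1 lt2.
  have [k0|k0] := eqVneq (k 0 i) 0.
    by move: vv'; rewrite k0 mulr0 => /eqP; rewrite subr_eq0 => /eqP[].
  have : (`|m| <= `|(m * k 0 i)%R|)%N by rewrite abszM leq_pmulr // absz_gt0.
  have small (a a' n : nat) : (a < n)%N -> (a' < n)%N -> (n <= `|(a%:Z - a'%:Z)%R|)%N -> False.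
    by lia.
  by rewrite -vv' => /(small _ _ _ lt2 lt1).
rewrite -(ler_nat R) natrX natrM cardT place_normM (place_norm_int hemb) -mulrA.
have -> : (`|m|%N%:R : R) = `|m|%:~R by rewrite -[in RHS]abszE.
rewrite -[leLHS]mulr1 ler_pM2l // exprn_gt0 // ltr0z normr_gt0 //.
Qed.

End NormBounds.

(** * Real inequalities behind the threshold c(M,K) *)

(** Once expanded, the difference of the products of the B_i + e and of the B_i is a sum of
    nonnegative terms increasing in each B_i, hence largest when every B_i is u. The induction
    splits off one factor. *)
Lemma prod_add_le (R : realDomainType) (I : finType) (B : I -> R) (u e : R) :
  0 <= e -> (forall i, 0 <= B i <= u) ->
  \prod_i (B i + e) <= (u + e) ^+ #|I| - u ^+ #|I| + \prod_i B i.
Proof.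
move=> e0 Bu; rewrite -!sum1_card -!big_enum /=.
suff H (s : seq I) : \prod_(i <- s) (B i + e) - \prod_(i <- s) B i
     <= (u + e) ^+ size s - u ^+ size s.
  have := H (enum I); rewrite lerBlDr.
  by rewrite (big_enum _ _ _ (fun=> 1%N)) sum1_card cardE.
elim: s => [|i s IHs]; first by rewrite !big_nil !expr0 !subrr.
rewrite !big_cons !exprS /=; have /andP[Bi Biu] := Bu i.
set A := \prod_(j <- s) (B j + e) in IHs *.
set A' := \prod_(j <- s) B j in IHs *.
have u0 : 0 <= u by exact: le_trans Biu.
have AA' : 0 <= A - A'.
  rewrite subr_ge0; apply: ler_prod => j _; have /andP[Bj _] := Bu j.
  by rewrite Bj lerDl.
have Aue : A <= (u + e) ^+ size s.
  rewrite -(count_predT s) -iter_mulr_1 -big_const_seq; apply: ler_prod => j _.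
  by have /andP[Bj Bju] := Bu j; rewrite addr_ge0 // lerD2r.
have -> : (B i + e) * A - B i * A' = B i * (A - A') + e * A by ring.
have -> : (u + e) * (u + e) ^+ size s - u * u ^+ size s
  = u * ((u + e) ^+ size s - u ^+ size s) + e * (u + e) ^+ size s by ring.
by apply: lerD; [exact: ler_pM | exact: ler_wpM2l].
Qed.

Section Balance.
Variables (R : realType).

(** Continuity at eta = 0: the strict inequality leaves room for the eta lost in
    [balanced_associate]. *)
Lemma expR_shift_lt (d : nat) (u e c : R) : (u + e) ^+ d - u ^+ d < c ->
  exists2 eta : R, 0 < eta & (u * expR eta + e) ^+ d - (u * expR eta) ^+ d < c.
Proof.
move=> lt_c.
pose f (t : R) := (u * expR t + e) ^+ d - (u * expR t) ^+ d.
have cu : u * expR t @[t --> (0 : R)] --> u * expR 0.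
  by apply: cvgM; [exact: cvg_cst|exact: continuous_expR].
have cf : f t @[t --> (0 : R)] --> f 0.
  apply: cvgB; last exact: cvg_comp cu (@exprn_continuous _ d _).
  have cue : u * expR t + e @[t --> (0 : R)] --> u * expR 0 + e.
    by apply: cvgD => //; exact: cvg_cst.
  exact: cvg_comp cue (@exprn_continuous _ d _).
have f0 : f 0 < c by rewrite /f expR0 mulr1.
have : nbhs (0 : R) [set t | f t < c] by exact: cvgr_lt cf c f0.
move=> /nbhs_ballP[r /= r0 rP].
exists (r / 2); first by rewrite divr_gt0.
apply: (rP (r / 2)); rewrite /ball /= sub0r normrN ger0_norm ?divr_ge0 // ?ltW //.
by rewrite ltr_pdivrMr // mulr_natr mulr2n ltrDl.
Qed.

(** With u = eps T0, x the d-th root in [const_cMK] and n = N^(1/d), the hypothesis on N reads M / n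
    < u (x - 1). So u + M / n < u x, and (u x)^d = u^d + 1 - eps^d. *)
Lemma threshold_lt (d : nat) (M : int) (eps T0 : R) (N : nat) : (0 < d)%N ->
  0 < eps < 1 -> 0 < T0 -> (0 < N)%N -> 0 <= (M%:~R : R) ->
  const_cMK d M eps T0 < N%:R ->
  (eps * T0 + M%:~R / N%:R `^ (d%:R^-1)) ^+ d - (eps * T0) ^+ d < 1 - eps ^+ d.
Proof.
move=> d0 /andP[eps0 eps1] T0p N0 M0; rewrite /const_cMK.
set x := _ `^ _.
have u0 : 0 < eps * T0 by rewrite mulr_gt0.
have ud0 : 0 < eps ^+ d * T0 ^+ d by rewrite mulr_gt0 // exprn_gt0.
have epsd : eps ^+ d < 1 by rewrite exprn_ilt1 // ?ltW // -lt0n.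
set z := (1 - eps ^+ d) / (eps ^+ d * T0 ^+ d).
have z0 : 0 < z by rewrite divr_gt0 // subr_gt0.
have root (t : R) : 0 < t -> (t `^ (d%:R^-1)) ^+ d = t.
  move=> t0; rewrite -powR_mulrn ?powR_ge0 // -powRrM mulVf ?powRr1 ?ltW //.
  by rewrite pnatr_eq0 -lt0n.
have xd : x ^+ d = z + 1 by rewrite root // addr_gt0.
have x0 : 0 <= x by exact: powR_ge0.
have x1 : 1 < x by rewrite -(@ltr_pXn2r _ d) ?nnegrE // expr1n xd ltrDr.
have Np : 0 < N%:R :> R by rewrite ltr0n.
set n := N%:R `^ _.
have n0 : 0 < n by rewrite powR_gt0.
have -> : (N%:R : R) = n ^+ d by rewrite root.
have den : 0 < eps * T0 * (x - 1) by rewrite mulr_gt0 // subr_gt0.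
have Mden : 0 <= M%:~R / (eps * T0 * (x - 1)) by rewrite divr_ge0 // ltW.
have n_ge0 : 0 <= n by exact: ltW.
rewrite ltr_pXn2r ?nnegrE //.
rewrite ltr_pdivrMr // -ltr_pdivrMl // mulrC => Mn.
have sum_ge0 : 0 <= eps * T0 + M%:~R / n by rewrite addr_ge0 ?divr_ge0 // ltW.
have prod_ge0 : 0 <= eps * T0 * x by rewrite mulr_ge0 // ltW.
rewrite ltrBlDr; apply: (@lt_le_trans _ _ ((eps * T0 * x) ^+ d)).
  rewrite ltr_pXn2r ?nnegrE //.
  by move: Mn; set v := eps * T0; lra.
by rewrite exprMn xd !exprMn mulrDr mulr1 /z mulrC divfK ?gt_eqF.
Qed.

End Balance.

(** * Floor functions on the completion *)

Section OtherPrimes.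
Variables (K : fieldExtType rat) (b : (\dim {:K}).-tuple K).
Hypothesis hb : integral_basis b.
Local Notation O := (@ring_of_integers K).
Variable P : set K.
Hypothesis hP : prime_ideal P.

Lemma prime_ideal_incomparable Q : prime_ideal Q -> Q <> P -> exists2 z, P z & ~ Q z.
Proof.
move=> hQ QP; apply: contrapT => noz; apply: QP.
have PQ : P `<=` Q by move=> z Pz; apply: contrapT => Qz; apply: noz; exists z.
apply/seteqP; split => // y Qy; apply: contrapT => Py.
have [r [q [Or Pq E]]] := prime_maximal hb hP (prime_sub hQ Qy) Py.
apply: (prime1 hQ); rewrite E; apply: (primeD hQ); last exact: PQ.
exact: (primeM hQ).
Qed.

(** For a prime Q other than P, take z in P outside Q. Then z^m x is an integer and z^m is
    invertible modulo every power of Q, so x has no pole at Q. *)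
Lemma integral_outside_integers_outside x :
  integral_outside P x -> integers_outside P x.
Proof.
move=> [m mx] Q hQ QP; rewrite /ideal_val; case: eqP => [_|x0]; first exact: leey.
rewrite lee_fin; case: xgetP => // n _ [a [c [k [l [[Oa Oc] xE [ak ak1] [cl cl1] ->]]]]].
rewrite subr_ge0 lez_nat leqNgt; apply/negP => kl; apply: ak1.
have [z Pz Qz] := prime_ideal_incomparable hQ QP.
have Oz := prime_sub hP Pz.
have c0 : c != 0 by apply: contra_notN cl1 => /eqP ->; exact: idealX0.
have Ozx := mx _ (idealX_expr m Pz).
have [r [q [Or Qq E]]] :=
  idealX_comaximal hb hQ k.+1 (integersX m Oz) (prime_expN hQ (n := m) Oz Qz).
rewrite -[a]mul1r E mulrDl; apply: idealXD; last first.
  by rewrite mulrC; exact: (idealXM hQ).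
have -> : r * z ^+ m * a = r * (z ^+ m * x) * c by rewrite xE; field.
apply: (idealXM hQ); first exact: integersM.
exact: (idealX_le hQ) cl.
Qed.

End OtherPrimes.

Section Completion.
Variables (K : fieldExtType rat) (b : (\dim {:K}).-tuple K).
Hypothesis hb : integral_basis b.
Local Notation O := (@ring_of_integers K).
Variable P : set K.
Hypothesis hP : prime_ideal P.
Variables gamma pi : K.
Hypothesis gammaP : forall x, P x -> O (gamma * x).
Hypothesis Ppi : P pi.
Hypothesis Pu : ~ P (gamma * pi).
Local Notation order_ge := (order_ge P gamma).

(** A fraction with a rational integer as denominator has orders at P, so the choice in [ideal_val]
    never falls back on its default. *)
Lemma ideal_val_fraction x : x != 0 -> exists a c k l,
  [/\ [/\ O a, O c & c != 0], x = a / c, has_order P a k, has_order P c l &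
      ideal_val P x = (k%:Z - l%:Z)%:E].
Proof.
move=> x0; rewrite /ideal_val (negPf x0).
case: xgetP => [n _ [a [c [k [l [[Oa Oc] xE ak cl ->]]]]]|none].
  exists a, c, k, l; split => //; split => //.
  by case: cl => _; apply: contra_notN => /eqP ->; exact: idealX0.
have [m m0 Om] := integers_denominator hb x.
have mK0 : m%:~R != 0 :> K by rewrite numfield_int_eq0.
have Omz := integers_int K m.
have [l cl] := has_order_exists hb hP gammaP Ppi Pu Omz mK0.
have [k ak] := has_order_exists hb hP gammaP Ppi Pu Om (mulf_neq0 mK0 x0).
case: (none (k%:Z - l%:Z)); exists (m%:~R * x), m%:~R, k, l; split => //.
by rewrite mulrAC mulfV // mul1r.
Qed.

Lemma has_order_unit c l : O c -> has_order P c l ->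
  O (gamma ^+ l * c) /\ ~ P (gamma ^+ l * c).
Proof.
move=> Oc [cl cl1]; split; first exact: (gammaX gammaP).
move=> /gammaP; rewrite mulrA -exprS => Ogc; apply: cl1.
apply: (idealX_order_ge hb hP gammaP Ppi Pu) => //.
by exists 1; split; [exact: integers1|exact: (prime1 hP)|rewrite mul1r].
Qed.

Lemma ideal_val_ge1 x : (1%:E <= ideal_val P x)%E <-> order_ge 1 x.
Proof.
have [->|x0] := eqVneq x 0.
  rewrite /ideal_val eqxx leey; split => // _; exists 1.
  by split; [exact: integers1|exact: (prime1 hP)|rewrite mulr0; exact: integers0].
have [a [c [k [l [[Oa Oc c0] xE [ak ak1] cl ->]]]]] := ideal_val_fraction x0.
rewrite lee_fin; split=> [kl|x1].
  have [Ou Pv] := has_order_unit Oc cl.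
  exists (gamma ^+ l * c); split => //.
  have -> : gamma ^+ l * c * gamma ^+ 1 * x = gamma ^+ l.+1 * a.
    by rewrite xE (exprS gamma l); field.
  by apply: (gammaX gammaP); apply: (idealX_le hP) ak; lia.
apply: contrapT => kl; apply: ak1; apply: (idealX_order_ge hb hP gammaP Ppi Pu) => //.
have -> : a = x * c by rewrite xE divfK.
have [cl0 _] := cl.
have := order_geM hP x1 (order_ge_idealX hP gammaP cl0).
by apply: (order_ge_sub hP gammaP Ppi Pu); lia.
Qed.

(** Were the valuation of pi at least 2, the numerator a = pi c would have order at least l + 2;
    cancelling pi would give c order at least l + 1, against the choice of l. *)
Lemma ideal_val_pi : (ideal_val P pi <= 1%:E)%E.
Proof.
have pi0 : pi != 0 by apply: contra_notN Pu => /eqP ->; rewrite mulr0; exact: (prime0 hP).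
have [a [c [k [l [[Oa Oc c0] xE [ak _] [_ cl1] ->]]]]] := ideal_val_fraction pi0.
rewrite lee_fin; apply: contrapT => kl; apply: cl1.
apply: (idealX_order_ge hb hP gammaP Ppi Pu) => //.
apply: (order_ge_pi hP gammaP Ppi Pu).
have -> : pi * c = a by rewrite xE divfK.
by apply: (order_ge_sub hP gammaP Ppi Pu) (order_ge_idealX hP gammaP ak); lia.
Qed.

Variable C : completion P.

(** For the converse, divide by pi: its valuation is at most 1, so the quotient is in the valuation
    ring. *)
Lemma extended_ideal_val (z : C) :
  @extended_ideal K P C z <-> (1%:E <= completion_val z)%E.
Proof.
split.
  move: z; apply: idealM_sub => [|x y x1 y1|_ y [p Pp <-] y0].
  - by rewrite (completion_val_pinfty 0).2 // leey.
  - by apply: le_trans (completion_valD x y); rewrite le_min x1 y1.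
  - rewrite completion_valM.
    have : (1%:E <= completion_val (completion_emb C p))%E.
      rewrite completion_val_emb; apply/ideal_val_ge1; exists 1.
      by split; [exact: integers1|exact: (prime1 hP)|rewrite mul1r; exact: gammaP].
    by move=> /le_trans; apply; rewrite leeDl.
move=> z1.
have pi0 : pi != 0 by apply: contra_notN Pu => /eqP ->; rewrite mulr0; exact: (prime0 hP).
have e0 : completion_emb C pi != 0 by rewrite fmorph_eq0.
have zE : z = completion_emb C pi * (z / completion_emb C pi) by rewrite mulrCA divff ?mulr1.
rewrite zE; apply: idealM_mul; first by exists pi.
rewrite /valuation_ring /=.
move: z1; rewrite {1}zE completion_valM completion_val_emb.
have := ideal_val_pi; have := @completion_val_ninfty _ _ C (z / completion_emb C pi).
case: (completion_val _) => [r||] //=; case: (ideal_val P pi) => [s||] //= _.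
by rewrite -EFinD !lee_fin; lia.
Qed.

Lemma extended_idealB (x y : C) :
  @extended_ideal K P C x -> @extended_ideal K P C y -> @extended_ideal K P C (x - y).
Proof.
move=> ex ey; apply: idealM_add => //; move: y ey.
apply: idealM_sub => [|x' y'|_ y [p Pp <-] y0].
- by rewrite oppr0; exact: idealM0.
- by rewrite opprD; exact: idealM_add.
rewrite -mulNr -rmorphN; apply: idealM_mul => //; exists (- p) => //.
exact: (primeN hP).
Qed.

Lemma extended_idealN (x : C) : @extended_ideal K P C x -> @extended_ideal K P C (- x).
Proof. by rewrite -[- x]sub0r; apply: extended_idealB; exact: idealM0. Qed.

Lemma extended_ideal_emb (x : K) :
  @extended_ideal K P C (completion_emb C x) <-> order_ge 1 x.
Proof.
by rewrite -ideal_val_ge1 -(completion_val_emb C); exact: extended_ideal_val.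
Qed.

Lemma extended_ideal_dense (x : C) :
  exists y, @extended_ideal K P C (x - completion_emb C y).
Proof.
by have [y y1] := completion_dense x 1; exists y; apply/extended_ideal_val.
Qed.

(** The set handed to [xget] depends only on the class of x modulo P O_P, which gives condition (iv)
    of a floor function; the zero class is sent to 0 for condition (iii). *)
Definition chosen_floor (good : K -> Prop) (x : C) : K :=
  if `[< @extended_ideal K P C x >] then 0
  else xget 0 [set a | good a /\ @extended_ideal K P C (x - completion_emb C a)].

Lemma chosen_floor_spec (good : K -> Prop) : good 0 ->
  (forall y, exists2 a, good a & order_ge 1 (y - a)) ->
  forall x, good (chosen_floor good x) /\
    @extended_ideal K P C (x - completion_emb C (chosen_floor good x)).
Proof.
move=> good0 goodP x; rewrite /chosen_floor; case: asboolP => [ex|_].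
  by rewrite rmorph0 subr0.
case: xgetP => [a _ //|none].
have [y xy] := extended_ideal_dense x.
have [a ga /extended_ideal_emb ya] := goodP y.
case: (none a); split => //.
have -> : x - completion_emb C a = (x - completion_emb C y) - - completion_emb C (y - a).
  by rewrite rmorphB; ring.
by apply: extended_idealB => //; exact: extended_idealN.
Qed.

Lemma chosen_floor0 good : chosen_floor good 0 = 0.
Proof. by rewrite /chosen_floor asboolT //; exact: idealM0. Qed.

Lemma chosen_floor_congr good x y : @extended_ideal K P C (x - y) ->
  chosen_floor good x = chosen_floor good y.
Proof.
move=> exy.
have sh z : @extended_ideal K P C (x - z) <-> @extended_ideal K P C (y - z).
  split=> ez.
    have -> : y - z = (x - z) - (x - y) by ring.
    exact: extended_idealB.
  have -> : x - z = (x - y) - - (y - z) by ring.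
  by apply: extended_idealB => //; exact: extended_idealN.
rewrite /chosen_floor.
have -> : `[< @extended_ideal K P C x >] = `[< @extended_ideal K P C y >].
  by apply: asbool_equiv_eq; have := sh 0; rewrite !subr0.
congr (if _ then _ else xget _ _); apply/seteqP; split=> a [ga ea]; split => //.
  exact/sh.
exact/sh.
Qed.

End Completion.

(** * Finiteness of expansions *)

(** If r > q, Bernoulli's inequality makes (r / q)^n exceed any constant D. *)
Lemma pow_bounded_le (R : realType) (q r D : R) : 0 < q ->
  (forall n, r ^+ n <= D * q ^+ n) -> r <= q.
Proof.
move=> q0 rD; rewrite leNgt; apply/negP => qr.
pose h := r / q - 1.
have h0 : 0 < h by rewrite subr_gt0 ltr_pdivlMr // mul1r.
have bern n : n%:R * h <= (r / q) ^+ n.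
  have -> : r / q = 1 + h by rewrite /h addrC subrK.
  suff : 1 + n%:R * h <= (1 + h) ^+ n by apply: le_trans; rewrite lerDr.
  elim: n => [|n IHn]; first by rewrite mul0r addr0 expr0.
  have : 0 <= n%:R * h * h by rewrite !mulr_ge0 // ltW.
  have : (1 + n%:R * h) * (1 + h) <= (1 + h) ^+ n * (1 + h).
    by rewrite ler_wpM2r // addr_ge0 // ltW.
  by rewrite exprSr -natr1; lra.
pose n := (Num.truncn (D / h)).+1.
have : n%:R * h <= D.
  apply: le_trans (bern n) _; rewrite expr_div_n ler_pdivrMr ?exprn_gt0 //.
rewrite -ler_pdivlMr // leNgt => /negP; apply; exact: truncnS_gt.
Qed.

Section Expansion.
Variables (R : realType) (K : fieldExtType rat) (r1 r2 : nat).
Variables (sigma : 'I_r1 -> {rmorphism K -> R}) (tau : 'I_r2 -> {rmorphism K -> R[i]}).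
Hypothesis hemb : embeddings_listed sigma tau.
Variable b : (\dim {:K}).-tuple K.
Hypothesis hb : integral_basis b.
Variable P : set K.
Hypothesis hP : prime_ideal P.
Variables gamma pi : K.
Local Notation O := (@ring_of_integers K).
Hypothesis gammaP : forall x, P x -> O (gamma * x).
Hypothesis Ppi : P pi.
Hypothesis Pu : ~ P (gamma * pi).
Local Notation nrm := (place_norm sigma tau).
Local Notation emb := (embedding sigma tau).
Local Notation normc := (@ComplexField.Normc.normc R).
Variables (C : completion P) (M : int) (B : embedding_index r1 r2 -> R).
Hypothesis B0 : forall e, 0 <= B e.

(** [j] is the denominator t_i of the partial quotient and [B e] the bound B_phi. *)
Definition small_multiple (a : K) (j : int) :=
  [/\ 0 < j < M, integral_outside P (j%:~R * a) &
      forall e, normc (emb e (j%:~R * a)) <= B e].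

Variable s : C -> K.
Hypothesis s_close : forall z, @extended_ideal K P C (z - completion_emb C (s z)).
Hypothesis s_small : forall z, exists j, small_multiple (s z) j.

Lemma finite_expansion_of_small : \prod_e (B e + M%:~R) < (ideal_norm P)%:R ->
  forall x : K, finite_expansion s (completion_emb C x).
Proof.
move=> BN x; apply: contrapT => infinite.
have [t tP] := choice s_small.
(* p = t_0 .. t_(n-2) V_(n-1) and q = t_0 .. t_(n-1) V_n, where k = t_(n-1), so that the
   n-th complete quotient V_(n-1) / V_n is k p / q. *)
pose next (st : K * K * int) := let: (p, q, k) := st in
  let y := completion_emb C (k%:~R * p / q) in
  (q, (t y)%:~R * (k%:~R * p - s y * q), t y).
pose st n := iter n next (x, 1, 1 : int).
pose p n := (st n).1.1; pose q n := (st n).1.2; pose k n := (st n).2.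
pose y n := completion_emb C ((k n)%:~R * p n / q n).
have stS n : [/\ p n.+1 = q n, k n.+1 = t (y n) &
    q n.+1 = (t (y n))%:~R * ((k n)%:~R * p n - s (y n) * q n)].
  by rewrite /y /p /q /k /st iterS; case: (iter n next _) => [[p' q'] k']; split.
(* The initial value k = 1 is then an admissible denominator, so that [kM] covers n = 0. *)
have M1 : 1 < M by have [/andP[]] := tP 0; lia.
have kM n : 0 < k n < M.
  case: n => [|n]; first by rewrite /k /= M1.
  by have [_ -> _] := stS n; have [] := tP (y n).
have intK (m : int) : 0 < m -> m%:~R != 0 :> K.
  by move=> m0; rewrite numfield_int_eq0 gt_eqF.
have quotients n : q n != 0 /\ complete_quotient s (completion_emb C x) n = Some (y n).
  elim: n => [|n [qn cqn]].
    by rewrite /q /y /p /k /= oner_eq0 mul1r divr1.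
  have [pS kS qS] := stS n.
  have : y n != completion_emb C (s (y n)).
    apply/negP => yE; apply: infinite; exists n.+1.
    by rewrite /partial_quotient /= cqn /= yE.
  rewrite /= cqn /= => yN; rewrite (negPf yN).
  have zN : (k n)%:~R * p n - s (y n) * q n != 0.
    apply: contraNneq yN => /eqP; rewrite subr_eq0 => /eqP E.
    by rewrite {1}/y E mulfK.
  have tK : (t (y n))%:~R != 0 :> K by apply: intK; have [/andP[]] := tP (y n).
  split; first by rewrite qS mulf_neq0.
  rewrite {3}/y pS kS qS -rmorphB -fmorphV; congr (Some (completion_emb C _)).
  have E : (k n)%:~R * p n / q n - s (y n) = ((k n)%:~R * p n - s (y n) * q n) / q n.
    by rewrite mulrBl mulfK.
  by rewrite E invf_div -mulf_div divff // mul1r.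
have [m m0 Om] := integers_denominator hb x.
have mK0 : m%:~R != 0 :> K by rewrite numfield_int_eq0.
have Oint := integers_int K.
have outside n : integral_outside P (m%:~R * p n) /\ integral_outside P (m%:~R * q n).
  elim: n => [|n [op oq]].
    by rewrite /p /q /= mulr1; split; exact: integral_outside_integer.
  have [-> _ ->] := stS n; split => //.
  have -> : m%:~R * ((t (y n))%:~R * ((k n)%:~R * p n - s (y n) * q n))
    = (t (y n))%:~R * ((k n)%:~R * (m%:~R * p n)) - (t (y n))%:~R * s (y n) * (m%:~R * q n).
    by ring.
  apply: (integral_outsideB hP).
  - by do 2![apply: integral_outsideZ; first exact: Oint].
  - by apply: integral_outsideM => //; have [] := tP (y n).
(* Each step multiplies q_n by t times the difference of the complete and partial quotients, which
   lies in the extended ideal and adds one to the order. *)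
have order n : order_ge P gamma n (q n).
  elim: n => [|n IHn]; first exact/(order_ge_integer hP)/integers1.
  have [_ _ ->] := stS n; have [qn _] := quotients n.
  apply: (order_geZ hP); first exact: Oint.
  have -> : (k n)%:~R * p n - s (y n) * q n = ((k n)%:~R * p n / q n - s (y n)) * q n.
    by rewrite mulrBl divfK.
  rewrite -add1n; apply: (order_geM hP) => //.
  apply/(extended_ideal_emb hb hP gammaP Ppi Pu C); rewrite rmorphB.
  exact: s_close.
pose Q e := B e + M%:~R.
have MR (j : int) : 0 < j < M -> `|j|%:~R <= (M%:~R : R).
  by move=> /andP[j0 jM]; rewrite ler_int gtr0_norm // ltW.
have MR0 : 0 <= (M%:~R : R) by rewrite ler0z; lia.
have Q1 e : 1 <= Q e.
  have : 1 <= (M%:~R : R) by rewrite ler1z; lia.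
  by have := B0 e; rewrite /Q; lra.
pose E e := Num.max 1 (normc (emb e x)) * Q e.
have normc_jM (j : int) (z : R[i]) : normc (j%:~R * z) = `|j|%:~R * normc z.
  by rewrite ComplexField.Normc.normcM normc_int.
(* p lags one step behind q, so its bound carries an extra factor Q, which absorbs the multiplier k
   <= M <= Q of p in the recurrence. E covers the initial values x and 1. *)
have growth e n : normc (emb e (p n)) * Q e <= E e * Q e ^+ n /\
    normc (emb e (q n)) <= E e * Q e ^+ n.
  have Q0 : 0 < Q e by exact: lt_le_trans (Q1 e).
  elim: n => [|n [gp gq]].
    rewrite expr0 mulr1 /p /q /= rmorph1 ComplexField.Normc.normc1 /E; split.
      by rewrite ler_wpM2r ?(ltW Q0) // le_max lexx orbT.
    by rewrite -[leLHS]mul1r ler_pM // le_max lexx.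
  have [-> _ ->] := stS n; split.
    by rewrite exprSr mulrA ler_wpM2r // ltW.
  have [/MR tM _ /(_ e) tB] := tP (y n); have kMn := MR _ (kM n).
  have -> : (t (y n))%:~R * ((k n)%:~R * p n - s (y n) * q n)
    = (t (y n))%:~R * ((k n)%:~R * p n) - (t (y n))%:~R * s (y n) * q n by ring.
  rewrite rmorphB; apply: le_trans (le_normcD _ _) _.
  rewrite normcN rmorphM rmorph_int normc_jM rmorphM rmorph_int normc_jM.
  rewrite [X in _ + normc X]rmorphM ComplexField.Normc.normcM.
  have -> : E e * Q e ^+ n.+1 = M%:~R * (E e * Q e ^+ n) + B e * (E e * Q e ^+ n).
    by rewrite exprSr /Q; ring.
  apply: lerD; last by apply: ler_pM => //; exact: normc_ge0.
  apply: ler_pM => //.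
  - by rewrite mulr_ge0 ?ler0z ?normc_ge0.
  apply: le_trans gp; rewrite mulrC ler_wpM2l ?normc_ge0 //.
  by apply: (le_trans kMn); rewrite /Q lerDr.
have bound n : (ideal_norm P)%:R ^+ n <= (nrm m%:~R * \prod_e E e) * (\prod_e Q e) ^+ n.
  have [qn _] := quotients n; have [_ oq] := outside n.
  have mq0 : m%:~R * q n != 0 by rewrite mulf_neq0.
  have on : order_ge P gamma n (m%:~R * q n) by apply: (order_geZ hP).
  (* Integral away from P by [oq] and of order at least 0 at P, hence an integer. *)
  have Omq : O (m%:~R * q n).
    rewrite -[X in O X]mul1r -(expr0 gamma).
    apply: (integral_outside_order_ge hb hP gammaP oq).
    exact: (order_ge_sub hP gammaP Ppi Pu) on.
  apply: le_trans (ideal_norm_pow_le hemb hb hP gammaP Ppi Pu Omq mq0 on) _.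
  rewrite place_normM -mulrA ler_wpM2l //; first exact/ltW/place_norm_gt0.
  rewrite -prodrXl -big_split /=; apply: ler_prod => e _.
  by rewrite normc_ge0 /=; have [] := growth e n.
have : (ideal_norm P)%:R <= \prod_e Q e.
  apply: pow_bounded_le bound; apply: prodr_gt0 => e _.
  exact: lt_le_trans (Q1 e).
by rewrite leNgt BN.
Qed.

End Expansion.

(** * The multiplier of P and the conclusion *)

Section Multiplier.
Variables (R : realType) (K : fieldExtType rat) (r1 r2 : nat).
Variables (sigma : 'I_r1 -> {rmorphism K -> R}) (tau : 'I_r2 -> {rmorphism K -> R[i]}).
Hypothesis hemb : embeddings_listed sigma tau.
Variable b : (\dim {:K}).-tuple K.
Hypothesis hb : integral_basis b.
Variable P : set K.
Hypothesis hP : prime_ideal P.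
Local Notation O := (@ring_of_integers K).
Local Notation emb := (embedding sigma tau).
Local Notation normc := (@ComplexField.Normc.normc R).
Local Notation d := (\dim {:K}).

Lemma prime_fractional_ideal : fractional_ideal P.
Proof.
have [[PO P0' PD PM] Pne _ _] := hP; split => //.
exists 1; split; [exact: integers1|exact: oner_neq0|].
by move=> x Px; rewrite mul1r; exact: PO.
Qed.

(** c / u still maps P into O, so [norm_multiplier_ge1] bounds the product of the B_phi by eps^d
    N(P), while the balancing unit bounds each of them as [prod_add_le] requires. *)
Lemma balanced_multiplier (M : int) (eps : R) (c : K) :
  0 < M -> 0 < eps < 1 -> c != 0 -> (forall x, P x -> O (c * x)) ->
  const_cMK d M eps (expR (covering_radius (log_unit_lattice sigma tau)))
    < (ideal_norm P)%:R ->
  exists2 u : K, unit_group u &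
    \prod_e (eps / normc (emb e (c / u)) + M%:~R) < (ideal_norm P)%:R.
Proof.
move=> M0 heps c0 cP hnorm.
set N := ideal_norm P in hnorm *; set T0 := expR _ in hnorm.
have /andP[eps0 eps1] := heps.
have d0 : (0 < d)%N by exact: (adim_gt0 {:K}%AS).
have N0 : (0 < N)%N.
  by have [code _] := ideal_norm_residues hb hP; exact: leq_ltn_trans (ltn_ord (code 0)).
have M0R : 0 <= (M%:~R : R) by rewrite ler0z ltW.
have := threshold_lt d0 heps (expR_gt0 _) N0 M0R hnorm.
set n := N%:R `^ _; set e0 := _ / n => /expR_shift_lt[eta eta0].
rewrite -mulrA -expRD; set T := expR _ => lt1.
have Np : 0 < N%:R :> R by rewrite ltr0n.
have n0 : 0 < n by rewrite powR_gt0.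
have nd : n ^+ d = N%:R.
  rewrite -powR_mulrn ?powR_ge0 // -powRrM mulVf ?powRr1 ?ltW //.
  by rewrite pnatr_eq0 -lt0n.
have e00 : 0 <= e0 by rewrite divr_ge0 // ltW.
have [u Uu uP] := balanced_associate hemb hb c0 eta0.
have [u0 Ou OVu] := Uu.
exists u => //.
have cu0 : c / u != 0 by rewrite mulf_neq0 ?invr_eq0.
have cuP x : P x -> O (c / u * x).
  by move=> Px; rewrite -mulrA; apply: cP; exact: (primeM hP).
have nc : 1 <= place_norm sigma tau c * N%:R by exact: (norm_multiplier_ge1 hemb hb hP c0 cP).
have ncu := norm_multiplier_ge1 hemb hb hP cu0 cuP.
have normp e : 0 < normc (emb e (c / u)) by exact: embedding_norm_gt0.
(* B_phi and M are both divided by n = N(P)^(1/d), the latter into [e0]; the product over the d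
   embeddings gives back the factor N(P). *)
pose B e := eps / normc (emb e (c / u)) / n.
have BT e : 0 <= B e <= eps * T.
  rewrite !divr_ge0 ?(ltW eps0) ?(ltW n0) ?normc_ge0 //=.
  rewrite /B -mulrA -invfM ler_pM2l // invf_ple ?posrE ?mulr_gt0 ?expR_gt0 //.
  rewrite -[leLHS]mul1r ler_pdivrMr ?expR_gt0 //.
  rewrite -(@ler_pXn2r _ d) ?nnegrE ?mulr_ge0 ?expR_ge0 ?normc_ge0 ?(ltW n0) //.
  rewrite expr1n mulrAC exprMn nd; apply: (le_trans nc).
  by rewrite ler_wpM2r ?(ltW Np) // uP.
have -> : \prod_e (eps / normc (emb e (c / u)) + M%:~R) = (\prod_e (B e + e0)) * N%:R.
  rewrite -nd -(card_embedding_index hemb) -prodr_const -big_split /=.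
  by apply: eq_bigr => e _; rewrite mulrDl /B /e0 !divfK ?gt_eqF.
rewrite -[ltRHS]mul1r ltr_pM2r //.
apply: le_lt_trans (prod_add_le e00 BT) _.
rewrite (card_embedding_index hemb).
suff Beps : \prod_e B e <= eps ^+ d.
  by apply: lt_le_trans (ltr_leD lt1 Beps) _; rewrite subrK.
rewrite /B prodf_div prodr_const (card_embedding_index hemb) nd.
rewrite prodf_div prodr_const (card_embedding_index hemb) -mulrA -invfM.
rewrite ler_pdivrMr; last by rewrite mulr_gt0 // (place_norm_gt0 sigma tau cu0).
by rewrite -[leLHS]mulr1 ler_wpM2l // exprn_ge0 // ltW.
Qed.

End Multiplier.

Theorem theorem5p8 (R : realType) (K : fieldExtType rat) (r1 r2 : nat)
    (sigma : 'I_r1 -> {rmorphism K -> R})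
    (tau : 'I_r2 -> {rmorphism K -> R[i]})
    (hemb : embeddings_listed sigma tau)
    (D : int) (hD : is_discriminant K D)
    (M : int) (hM : const_cK R (\dim {:K}) r2 D < M%:~R)
    (eps : R) (heps : 0 < eps < 1)
    (hcl : forall C : set (set K), ideal_class C ->
       exists A : set K,
         [/\ C A, integral_ideal A & approximation_property M eps A])
    (P : set K) (hP : prime_ideal P)
    (hnorm : const_cMK (\dim {:K}) M eps
               (expR (covering_radius (log_unit_lattice sigma tau)))
             < (ideal_norm P)%:R)
    (KP : completion P) :
  CFF_property KP [set m%:~R | m in [set m : int | 1 <= m <= M]].
Proof.
have [b hb _] := hD.
have [gamma [pi [gammaP Ppi Pu]]] := prime_inverse hb hP.
(* The approximation hypothesis is applied to the class of P itself, so that A = c P. *)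
have [A [[_ [c c0 AE]] [AO _ _ _] approx]] :=
  hcl _ (ex_intro2 _ _ P (prime_fractional_ideal hP) erefl).
have cP x : P x -> ring_of_integers (c * x).
  by move=> Px; apply: AO; rewrite AE; exists x.
have M0 : 0 < M by have [_ [j [_ jM _]]] := approx 0; lia.
have [u Uu] := balanced_multiplier hemb hb hP M0 heps c0 cP hnorm.
have [u0 Ou OVu] := Uu.
set B := fun e => eps / ComplexField.Normc.normc (embedding sigma tau e (c / u)).
rewrite -/(B _) => prodB.
have /andP[eps0 _] := heps.
have cu0 : c / u != 0 by rewrite mulf_neq0 ?invr_eq0.
have normp e : 0 < ComplexField.Normc.normc (embedding sigma tau e (c / u)).
  exact: embedding_norm_gt0.
have B0 e : 0 <= B e by rewrite divr_ge0 ?normc_ge0 // ltW.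
have intK (m : int) : 0 < m -> m%:~R != 0 :> K.
  by move=> m0; rewrite numfield_int_eq0 gt_eqF.
have Oint := integers_int K.
(* An integer 0 < j < M in P would give N(P) <= j^d <= prod (B_e + M) < N(P). So division by j
   preserves orders at P. *)
have notP (j : int) : 0 < j < M -> ~ P j%:~R.
  move=> /andP[j0 jM] Pj; move: prodB; apply/negP; rewrite -leNgt.
  have ordj : order_ge P gamma 1 j%:~R.
    by exists 1; split; [exact: integers1|exact: (prime1 hP)|rewrite mul1r; exact: gammaP].
  have := ideal_norm_pow_le hemb hb hP gammaP Ppi Pu (Oint j) (intK _ j0) ordj.
  rewrite expr1 => /le_trans; apply; apply: ler_prod => e _.
  rewrite normc_ge0 rmorph_int normc_int gtr0_norm //=.
  apply: (@le_trans _ _ M%:~R); first by rewrite ler_int ltW.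
  by rewrite lerDr; exact: B0.
pose good a := exists j, small_multiple sigma tau P M B a j.
have good0 : good 0.
  have [_ [j [_ jM _]]] := approx 0; exists j; split => //.
    by rewrite mulr0; apply: integral_outside_integer; exact: integers0.
  by move=> e; rewrite mulr0 rmorph0 ComplexField.Normc.normc0.
(* Approximate y by a' integral outside P, then (c / u) a' by c x / j with x in P. The candidate a =
   a' - u x / j has j a (c / u) = j (c / u) a' - c x, small at every embedding, and u x / j has
   order at least 1 at P. *)
have goodP y : exists2 a, good a & order_ge P gamma 1 (y - a).
  have [a' outa' ya'] := local_approximation hb hP gammaP Ppi Pu y.
  have [z [j [Az /andP[j0 jM] small]]] := approx (c / u * a').
  move: Az small; rewrite AE => -[x Px <-] small.
  have Pux : P (u * x) by exact: (primeM hP).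
  have jK := intK _ j0.
  have jaE : j%:~R * (a' - u * x / j%:~R) = j%:~R * a' - u * x by field.
  exists (a' - u * x / j%:~R).
    exists j; split; first by rewrite j0.
      rewrite jaE; apply: (integral_outsideB hP).
        by apply: integral_outsideZ.
      by apply: integral_outside_integer; exact: (prime_sub hP).
    move=> e; rewrite jaE /B ler_pdivlMr // -ComplexField.Normc.normcM -rmorphM.
    have -> : (j%:~R * a' - u * x) * (c / u) = j%:~R * (c / u * a') - c * x by field.
    exact/ltW/small.
  have -> : y - (a' - u * x / j%:~R) = (y - a') + u * x / j%:~R by ring.
  apply: (order_geD hP) => //; exists j%:~R; split => //; first by apply: notP; rewrite j0.
  have -> : j%:~R * gamma ^+ 1 * (u * x / j%:~R) = gamma * (u * x) by field.
  exact: gammaP.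
have spec := chosen_floor_spec hb hP gammaP Ppi Pu (C := KP) good0 goodP.
set s := @chosen_floor K P KP good in spec.
split.
- apply: finite_image; apply: (@sub_finite_set _ _ [set Posz n | n in `I_(`|M|.+1)]).
    by move=> m /= /andP[m1 mM]; exists `|m|%N; rewrite /=; lia.
  by apply: finite_image; exact: finite_II.
- move=> _ [m /andP[m1 mM] <-]; split; first exact: Oint.
  by move=> /eqP; apply/negP; apply: intK; lia.
exists s.
  split.
  - by move=> z; have [] := spec z.
  - move=> z; have [[j [/andP[j0 jM] outj _]] _] := spec z.
    exists j%:~R; first by exists j => //=; lia.
    exact: (integral_outside_integers_outside hb hP).
  - exact: chosen_floor0.
  - by move=> y z; exact: (chosen_floor_congr hP).
apply: (finite_expansion_of_small hemb hb hP gammaP Ppi Pu B0 _ _ prodB).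
  by move=> z; have [] := spec z.
by move=> z; have [] := spec z.
Qed.
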